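(* Let $f$ be a real measurable function on $[0,1]^{\mathbb{N}}$. For $p\in\{1,2\}$ define $$N_p(f)=\limsup_{n\to\infty}\ \limsup_{m\to\infty}\ \sum_{j=0}^{n}\sum_{i=1}^{m}\mathbb{E}\bigl(|\Delta_{i,j}^{m,n}f|^p\bigr)^{\frac{2}{p}},$$ where the random variables $\Delta_{i,j}^{m,n}f$ are defined in the context. Suppose that $f$ belongs to $L^2([0,1]^{\mathbb{N}},\lambda^{\otimes\mathbb{N}})$ and that for every $n$ the function $f_n$ on $[0,1]^{n+1}$ defined by $$f_n(y_0,\ldots,y_n)=\int f(y_0,\ldots,y_n,y_{n+1},y_{n+2},\ldots)\ \bigotimes_{k\ge n+1}d\lambda(y_k)$$ is Riemann-integrable. Then $$N_2(f)\ \ge\ \frac{1}{2}\,\mathrm{Var}_{\lambda}(f)\,\log\frac{\mathrm{Var}_{\lambda}(f)}{N_1(f)}.$$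
   Context: $\mathbb{N}=\{0,1,2,\ldots\}$; $\lambda$ is Lebesgue measure on $[0,1]$, $\lambda^{\otimes\mathbb{N}}$ is the product measure on $[0,1]^{\mathbb{N}}$, and $\mathrm{Var}_\lambda(f)$ is the variance of $f$ with respect to $\lambda^{\otimes\mathbb{N}}$. $\log$ is the natural logarithm. Let $(x_{i,j})_{i\ge1,\,j\ge0}$ be independent symmetric Bernoulli random variables (values $0$ and $1$, each with probability $1/2$). For positive integers $m,n$, the random variable $X^{m,n}$ with values in $[0,1]^{\mathbb{N}}$ is defined by $$(X^{m,n})_j=\sum_{i=1}^m\frac{x_{i,j}}{2^i}\ \text{ if } j\le n,\qquad (X^{m,n})_j=\sum_{i\ge1}\frac{x_{i,j}}{2^i}\ \text{ if } j>n.$$ For a real function $f$ on $[0,1]^{\mathbb{N}}$, $$\Delta_{i,j}^{m,n}f=f(X^{m,n})-\mathbb{E}_{x_{i,j}}[f(X^{m,n})],$$ where $\mathbb{E}_{x_{i,j}}$ denotes expectation with respect to $x_{i,j}$ only (all other variables being held fixed). The Riemann-integrability hypothesis on $f_n$ includes that the integral defining $f_n(y_0,\ldots,y_n)$ makes sense for every $(y_0,\ldots,y_n)\in[0,1]^{n+1}$. The quantities $N_p(f)$ take values in $[0,+\infty]$. Convention: the right-hand side of the inequality is $0$ when $\mathrm{Var}_\lambda(f)=0$, and when $\mathrm{Var}_\lambda(f)>0$ it is $-\infty$ if $N_1(f)=+\infty$ and $+\infty$ if $N_1(f)=0$. *)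

(* Defs.v *)
From HB Require Import structures.
From mathcomp Require Import all_boot all_order all_algebra.
From mathcomp Require Import interval_inference.
From mathcomp Require Import all_classical all_reals all_analysis.

Set Implicit Arguments.
Unset Strict Implicit.
Unset Printing Implicit Defensive.

Import Order.TTheory GRing.Theory Num.Theory.
Import numFieldNormedType.Exports.

Local Open Scope classical_set_scope.
Local Open Scope ring_scope.

HB.instance Definition _ (R : realType) := isPointed.Build {i01 R} (0%:i01).

Definition cylinders (R : realType) : set (set (nat -> {i01 R})) :=
  [set B | exists j, exists2 A : set R,
     measurable A & B = [set y | A (y j)%:num]].

Definition cube (R : realType) := g_sigma_algebraType (@cylinders R).

(** The infinite product of the Lebesgue measures on [0,1] is the unique
    probability measure on [cube R] with these values on finite-dimensional
    boxes. *)
Definition is_lebesgue_product (R : realType) (lam : probability (cube R) R) :=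
  forall (n : nat) (A : nat -> set R), (forall j, measurable (A j)) ->
  lam [set y : cube R | forall j, (j <= n)%N -> A j (y j)%:num] =
  (\prod_(j < n.+1) lebesgue_measure (A j `&` `[0%R, 1%R]))%E.

(** The point (y_0, ..., y_{d-1}, z_0, z_1, ...). *)
Definition splice (R : realType) (d : nat) (y : 'I_d -> {i01 R})
    (z : cube R) : cube R :=
  fun j => if insub j is Some k then y k else z (j - d)%N.

(** The function f_n of n.+1 variables. The variables of index k >= n+1 are
    relabelled as z_0, z_1, ..., so that they again range over [0,1]^N. *)
Definition tail_integral (R : realType) (lam : probability (cube R) R)
    (f : cube R -> R) (n : nat) (y : 'I_n.+1 -> {i01 R}) : R :=
  \int[lam]_z f (splice y z).

(** [p k] subdivides the k-th side into [N] intervals. Repeated points are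
    allowed, so it is no restriction that [N] is the same for all sides. *)
Definition is_grid (R : realType) (d N : nat) (p : 'I_d -> nat -> R) :=
  forall k, [/\ p k 0%N = 0, p k N = 1 &
    forall i, (i < N)%N -> p k i <= p k i.+1].

Definition mesh_lt (R : realType) (d N : nat) (p : 'I_d -> nat -> R)
    (delta : R) :=
  forall k i, (i < N)%N -> p k i.+1 - p k i < delta.

(** The cells are indexed by [c : {ffun 'I_d -> 'I_N}]; the cell [c] is the
    product of the intervals [[p k (c k), p k (c k).+1]], and [t c] is the
    evaluation point chosen in it. *)
Definition is_tagging (R : realType) (d N : nat) (p : 'I_d -> nat -> R)
    (t : {ffun 'I_d -> 'I_N} -> 'I_d -> {i01 R}) :=
  forall (c : {ffun 'I_d -> 'I_N}) k, p k (c k) <= (t c k)%:num <= p k (c k).+1.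

Definition riemann_sum (R : realType) (d N : nat) (p : 'I_d -> nat -> R)
    (t : {ffun 'I_d -> 'I_N} -> 'I_d -> {i01 R})
    (g : ('I_d -> {i01 R}) -> R) : R :=
  \sum_(c : {ffun 'I_d -> 'I_N}) g (t c) * \prod_k (p k (c k).+1 - p k (c k)).

Definition riemann_integrable (R : realType) (d : nat)
    (g : ('I_d -> {i01 R}) -> R) :=
  exists I : R, forall eps : R, 0 < eps -> exists2 delta : R, 0 < delta &
  forall (N : nat) (p : 'I_d -> nat -> R)
    (t : {ffun 'I_d -> 'I_N} -> 'I_d -> {i01 R}),
    is_grid N p -> mesh_lt N p delta -> is_tagging p t ->
    `|riemann_sum p t g - I| < eps.

Definition dyadic (R : realType) (b : nat -> bool) (m : nat) : R :=
  \sum_(1 <= i < m.+1) (b i)%:R / 2 ^+ i.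

Lemma dyadic_ge0 (R : realType) b m : 0 <= dyadic R b m.
Proof. by apply: sumr_ge0 => i _; rewrite divr_ge0// exprn_ge0. Qed.

Lemma dyadic_le (R : realType) b m : dyadic R b m <= 1 - 2^-1 ^+ m.
Proof.
elim: m => [|m IH]; first by rewrite /dyadic big_geq// expr0 subrr.
have half : 2^-1 ^+ m = 2^-1 ^+ m.+1 + 2^-1 ^+ m.+1 :> R.
  rewrite [_ ^+ m.+1]exprS -mulrDl.
  by have := splitr (1 : R); rewrite !mul1r => <-; rewrite mul1r.
have term : (b m.+1)%:R / 2 ^+ m.+1 <= 2^-1 ^+ m.+1 :> R.
  rewrite exprVn ler_piMl// ?invr_ge0 ?exprn_ge0//.
  by case: (b _); rewrite ?ler01.
rewrite /dyadic big_nat_recr//=.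
apply: le_trans (lerD IH term) _.
by rewrite half opprD addrA subrK.
Qed.

Lemma dyadic_le1 (R : realType) b m : dyadic R b m <= 1.
Proof.
by rewrite (le_trans (dyadic_le R b m))// gerBl exprn_ge0// invr_ge0.
Qed.

Lemma is_cvg_dyadic (R : realType) b : cvgn (dyadic R b).
Proof.
apply: nondecreasing_is_cvgn; last first.
  by exists 1 => _ [m _ <-]; exact: dyadic_le1.
apply/nondecreasing_seqP => m.
by rewrite {2}/dyadic big_nat_recr//= lerDl divr_ge0// exprn_ge0.
Qed.

Definition binary (R : realType) (b : nat -> bool) : R := limn (dyadic R b).

Lemma binary_ge0 (R : realType) b : 0 <= binary R b.
Proof.
by apply: limr_ge; [exact: is_cvg_dyadic|apply: nearW => m; exact: dyadic_ge0].
Qed.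

Lemma binary_le1 (R : realType) b : binary R b <= 1.
Proof.
by apply: limr_le; [exact: is_cvg_dyadic|apply: nearW => m; exact: dyadic_le1].
Qed.

(** [b i j] is the value of the bit x_{i,j}; the row [i = 0] is not used. *)
Definition Xseq (R : realType) (m n : nat) (b : nat -> nat -> bool) : cube R :=
  fun j => if (j <= n)%N
    then Itv01 (dyadic_ge0 R (b ^~ j) m) (dyadic_le1 R (b ^~ j) m)
    else Itv01 (binary_ge0 R (b ^~ j)) (binary_le1 R (b ^~ j)).

Definition independent_RVs d (T : measurableType d) (R : realType)
    (P : probability T R) d' (T' : measurableType d') (I : choiceType)
    (D : set I) (x : I -> {RV P >-> T'}) :=
  forall (J : seq I) (A : I -> set T'), uniq J ->
    (forall k, k \in J -> D k) -> (forall k, measurable (A k)) ->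
    P [set w | forall k, k \in J -> A k (x k w)] =
    (\prod_(k <- J) P (x k @^-1` A k))%E.

Definition iid_symmetric_bits d (T : measurableType d) (R : realType)
    (P : probability T R) (x : nat -> nat -> {RV P >-> bool}) :=
  independent_RVs [set k | (1 <= k.1)%N] (fun k : nat * nat => x k.1 k.2) /\
  forall i j, (1 <= i)%N -> distribution P (x i j) =1 bernoulli_prob 2^-1.

Section functionals.
Context d (T : measurableType d) (R : realType) (P : probability T R).
Variable x : nat -> nat -> {RV P >-> bool}.

Definition bits (w : T) (i j : nat) : bool := x i j w.

Definition set_bit (b : nat -> nat -> bool) (i j : nat) (v : bool) :
    nat -> nat -> bool :=
  fun k l => if (k == i) && (l == j) then v else b k l.

(** E_{x_{i,j}}[F(x)] at [w]: only x_{i,j} is averaged over, all the other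
    bits keep their value at [w]. *)
Definition expectation_bit (i j : nat) (F : (nat -> nat -> bool) -> R)
    (w : T) : R :=
  fine 'E_P[fun w' => F (set_bit (bits w) i j (x i j w'))].

Definition Delta (f : cube R -> R) (m n i j : nat) (w : T) : R :=
  f (Xseq R m n (bits w)) -
  expectation_bit i j (fun b => f (Xseq R m n b)) w.

Definition Nfun (p : nat) (f : cube R -> R) : \bar R :=
  limn_esup (fun n => limn_esup (fun m =>
    \sum_(0 <= j < n.+1) \sum_(1 <= i < m.+1)
      'E_P[fun w => (`|Delta f m n i j w| ^+ p)%R] `^ (2 / p%:R)))%E.

End functionals.

(* Main.v *)
Require Import Defs.
From HB Require Import structures.
From mathcomp Require Import all_boot all_order all_algebra.
From mathcomp Require Import interval_inference ring lra zify.
From mathcomp Require Import all_classical all_reals all_analysis.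
From mathcomp Require Import unstable measurable_realfun.

Set Implicit Arguments.
Unset Strict Implicit.
Unset Printing Implicit Defensive.

Import Order.TTheory GRing.Theory Num.Theory.
Import numFieldNormedType.Exports.

Local Open Scope classical_set_scope.
Local Open Scope ring_scope.

(** On the discrete cube, split a function [g] of finitely many bits along its
    martingale differences: each difference satisfies the logarithmic Sobolev
    inequality, whose entropy term is bounded below through its first two
    moments. This gives the Falik-Samorodnitsky inequality, kept in the form
    [Var(g) (1 + ln l) - l * sum_k (E|D_k g|)^2 <= 2 * sum_k E|D_k g|^2]
    for every [l > 0]; it is linear in the variance, so it passes to the limit
    without any discussion of signs, and [l = Var / N_1] is chosen at the end.

    It is applied to [f_n] on the dyadic grid of level [m]: by Jensen, averaging
    over the coordinates of index larger than [n] only decreases the moments of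
    the [Delta_{i,j}]. Riemann integrability makes the variance of [f_n] on the
    grid converge to the variance of [f_n] as [m] grows (the oscillations over
    the dyadic cells are controlled by comparing Riemann sums), and the variance
    of [f_n] converges to that of [f] because functions of finitely many
    coordinates are dense in [L^2]. *)

(** * The two-point logarithmic Sobolev inequality *)

(** Fixing [l] linearises the target: for positive Var and N_1, the supremum over [l] of Var (1 + ln
    l) - l N_1 is attained at l = Var / N_1, where l N_1 = Var cancels the 1 and leaves Var ln (Var
    / N_1). The factor 1/2 is the inverse of the constant 2 of the logarithmic Sobolev inequality.
    For fixed [l], a strict upper bound on N_1 holds for the level sums at all large n, then all
    large m, and the resulting lower bound on the level sums for p = 2 only has to hold eventually;
    so the two iterated upper limits are compatible. The obstacle is that X^{m,n} mixes truncated
    coordinates with complete ones, while independence is given for finite families of bits only.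
    Everything is therefore computed on cylinders that fix finitely many bits: a bit is moved from
    the average into the cylinder, one at a time, until the function of the bits is constant there.
    Grid averages and integrals are compared by a coupling: the same bits produce a grid point and a
    point of the cube, and the two lie in one dyadic cell. *)

Lemma is_derive_ge0_le (R : realType) (f df : R -> R) (a b : R) : a <= b ->
  (forall x, a <= x <= b -> is_derive x 1 f (df x)) ->
  (forall x, a <= x <= b -> 0 <= df x) -> f a <= f b.
Proof.
move=> ab fD df0.
have fc : {within `[a, b], continuous f}.
  apply: derivable_within_continuous => x; rewrite in_itv/= => /fD [].
  by [].
have fD' x : x \in `]a, b[%R -> is_derive x 1 f (df x).
  by rewrite in_itv/= => /andP[/ltW ax /ltW xb]; apply: fD; rewrite ax.
have [c] := MVT_segment ab fD' fc; rewrite in_itv/= => cab fE.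
by rewrite -subr_ge0 fE mulr_ge0 ?df0// subr_ge0.
Qed.

(** Equality holds at c = 1, and x - ln ((1 + x^2) / 2) has derivative (1 - x)^2 / (1 + x^2). *)
Lemma ln_half_sqr_ge (R : realType) (c : R) : 0 <= c <= 1 ->
  c - 1 <= ln ((1 + c ^+ 2) / 2).
Proof.
move=> /andP[c0 c1].
pose f (x : R) := x - ln ((1 + x ^+ 2) / 2).
pose df (x : R) := 1 - ((1 + x ^+ 2) / 2)^-1 * x.
suff : f c <= f 1.
  rewrite /f expr1n (_ : (1 + 1) / 2 = 1 :> R) ?ln1; last by field.
  lra.
apply: (is_derive_ge0_le (df := df)) => [//||]; move=> x /andP[cx x1].
- have pos : 0 < (1 + x ^+ 2) / 2 by have := sqr_ge0 x; lra.
  have := is_derive1_ln pos => dln.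
  rewrite /f /df; apply: is_deriveB.
  have dg : is_derive x 1 (fun y : R => (1 + y ^+ 2) / 2) x.
    by apply: is_derive_eq; rewrite !scaler0 /GRing.scale/=; field.
  exact: (@is_derive1_comp _ (@ln R) (fun y : R => (1 + y ^+ 2) / 2)).
- have pos : 0 < (1 + x ^+ 2) / 2 by have := sqr_ge0 x; lra.
  by rewrite /df subr_ge0 ler_pdivrMl// mulr1; have := sqr_ge0 (x - 1); nra.
Qed.

(* The derivative in [a] of the right side minus the left side is
   [2 (a - 1) + 2 a (ln ((1 + c ^ 2) / 2))] with [c = 1 / a]. *)
Lemma two_point_log_sobolev1 (R : realType) (a : R) : 1 <= a ->
  a ^+ 2 * ln (a ^+ 2) <= (a ^+ 2 + 1) * ln ((a ^+ 2 + 1) / 2) + (a - 1) ^+ 2.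
Proof.
move=> a1; have a0 : 0 < a by lra.
pose f (x : R) := (x - 1) ^+ 2 + (x ^+ 2 + 1) * ln ((x ^+ 2 + 1) / 2)
  - x ^+ 2 * (2 * ln x).
pose df (x : R) := 2 * (x - 1) + 2 * x * ln ((x ^+ 2 + 1) / 2)
  - 4 * x * ln x.
suff : f 1 <= f a.
  rewrite /f ln1 !mulr0 expr1n (_ : (1 + 1) / 2 = 1 :> R) ?ln1; last by field.
  by rewrite lnXn// subrr expr0n/=; rewrite -[ln a *+ 2]mulr_natl; lra.
apply: (is_derive_ge0_le (df := df)) => [//||]; move=> x /andP[x1 xa].
- have x0 : 0 < x by lra.
  have pos : 0 < (x ^+ 2 + 1) / 2 by have := sqr_ge0 x; lra.
  have dln := is_derive1_ln x0.
  have dg : is_derive x 1 (fun y : R => (y ^+ 2 + 1) / 2) x.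
    by apply: is_derive_eq; rewrite !scaler0 /GRing.scale/=; field.
  have dh : is_derive x 1 (fun y : R => ln ((y ^+ 2 + 1) / 2))
      (((x ^+ 2 + 1) / 2)^-1 * x).
    by have dln' := is_derive1_ln pos;
       exact: (@is_derive1_comp _ (@ln R) (fun y : R => (y ^+ 2 + 1) / 2)).
  apply: is_derive_eq.
  rewrite /GRing.scale/= /df.
  have p2 : x * x + 1 != 0 by have := sqr_ge0 x; rewrite expr2; lra.
  by field; rewrite ?p2 ?gt_eqF.
- have x0 : 0 < x by lra.
  have xi0 : 0 < x^-1 by rewrite invr_gt0.
  have xi1 : x^-1 <= 1 by rewrite invf_le1.
  have := @ln_half_sqr_ge _ x^-1; rewrite (ltW xi0) xi1 => /(_ isT).
  have -> : (1 + x^-1 ^+ 2) / 2 = ((x ^+ 2 + 1) / 2) / x ^+ 2.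
    by field; rewrite gt_eqF.
  rewrite ln_div ?posrE ?exprn_gt0//; last by have := sqr_ge0 x; lra.
  rewrite lnXn// -[ln x *+ 2]mulr_natl => h.
  rewrite /df.
  have : x * (x^-1 - 1) <= x * (ln ((x ^+ 2 + 1) / 2) - 2 * ln x).
    by rewrite ler_pM2l.
  rewrite mulrBr divff ?gt_eqF//; lra.
Qed.

(** Scaling both variables by b multiplies each side by b^2 and adds the same multiple of ln (b^2),
    so the case of the ratio a / b >= 1 suffices. For b = 0 the claim reduces to ln 2 <= 1. *)
Lemma two_point_log_sobolev (R : realType) (a b : R) : 0 <= a -> 0 <= b ->
  a ^+ 2 * ln (a ^+ 2) + b ^+ 2 * ln (b ^+ 2) <=
  (a ^+ 2 + b ^+ 2) * ln ((a ^+ 2 + b ^+ 2) / 2) + (a - b) ^+ 2.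
Proof.
wlog ba : a b / b <= a.
  move=> H a0 b0; have [ba|/ltW ab] := leP b a; first exact: H.
  by rewrite addrC [a ^+ 2 + _]addrC -opprB sqrrN; exact: H.
move=> a0; rewrite le_eqVlt => /predU1P[<-|b0].
  rewrite expr0n/= mul0r !addr0 subr0.
  move: a0; rewrite le_eqVlt => /predU1P[<-|a0].
    by rewrite expr0n/= !mul0r addr0.
  have a20 : 0 < a ^+ 2 by rewrite exprn_gt0.
  rewrite ln_div ?posrE//.
  suff : a ^+ 2 * ln 2 <= a ^+ 2 * 1 by lra.
  rewrite ler_pM2l//; have := @le_ln1Dx R 1.
  by rewrite (_ : 1 + 1 = 2)//; apply; lra.
have b20 : 0 < b ^+ 2 by rewrite exprn_gt0.
pose r := a / b.
have r1 : 1 <= r by rewrite ler_pdivlMr// mul1r.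
have r0 : 0 < r by lra.
have r20 : 0 < r ^+ 2 by rewrite exprn_gt0.
have aE : a = r * b by rewrite /r divfK ?gt_eqF.
clearbody r; rewrite {a ba a0}aE.
have := two_point_log_sobolev1 r1.
rewrite exprMn.
have -> : (r ^+ 2 * b ^+ 2 + b ^+ 2) / 2 = ((r ^+ 2 + 1) / 2) * b ^+ 2 by field.
have q0 : 0 < (r ^+ 2 + 1) / 2 by lra.
rewrite (lnM q0) ?posrE// (lnM r20) ?posrE//.
rewrite -(ler_pM2l b20).
set L := ln (b ^+ 2); set L1 := ln (r ^+ 2); set L2 := ln _.
lra.
Qed.

(** * Functions of finitely many bits *)

Notation bit_array := (nat -> nat -> bool).

Definition flip (b : bit_array) (k : nat * nat) (v : bool) : bit_array :=
  set_bit b k.1 k.2 v.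

Lemma flipE b k v l : flip b k v l.1 l.2 = if l == k then v else b l.1 l.2.
Proof. by case: k l => [k1 k2] [l1 l2]; rewrite /flip /set_bit/= xpair_eqE. Qed.

Lemma bit_arrayP (b c : bit_array) :
  (forall l : nat * nat, b l.1 l.2 = c l.1 l.2) -> b = c.
Proof. by move=> bc; apply/funext => i; apply/funext => j; exact: (bc (i, j)). Qed.

Lemma flip_id b k v w : flip (flip b k w) k v = flip b k v.
Proof. by apply: bit_arrayP => l; rewrite !flipE; case: (l == k). Qed.

Lemma flipC b k l v w : k != l -> flip (flip b k v) l w = flip (flip b l w) k v.
Proof.
move=> kl; apply: bit_arrayP => i; rewrite !flipE.
by have [->|//] := eqVneq i l; rewrite eq_sym (negbTE kl).
Qed.

Section bit_mean.
Context {R : realType}.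
Implicit Types (g h : bit_array -> R) (s : seq (nat * nat)) (k l : nat * nat).
Implicit Types b : bit_array.

Definition bit_avg k h b : R := (h (flip b k true) + h (flip b k false)) / 2.

Definition half_diff k h b : R := (h (flip b k true) - h (flip b k false)) / 2.

Definition bit_diff k h b : R := h b - bit_avg k h b.

(** The expectation over the bits of [s], kept as a function of the other bits. No finite
    probability space has to be built, and conditional expectations are means over sublists. *)
Fixpoint bit_mean s h : bit_array -> R :=
  if s is k :: s' then bit_mean s' (bit_avg k h) else h.

Lemma bit_avgC k l h : bit_avg k (bit_avg l h) = bit_avg l (bit_avg k h).
Proof.
have [->//|kl] := eqVneq k l.
apply/funext => b; rewrite /bit_avg !(flipC _ _ _ kl).
lra.
Qed.

Lemma bit_mean_avg s k h : bit_mean s (bit_avg k h) = bit_avg k (bit_mean s h).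
Proof. by elim: s h => //= l s IH h; rewrite bit_avgC IH. Qed.

(** The recursion averages over [k] first. Since averages commute, [k] may come last, which is the
    form needed when an induction cuts the cube into the two halves given by [k]. *)
Lemma bit_mean_cons k s h b : bit_mean (k :: s) h b =
  (bit_mean s h (flip b k true) + bit_mean s h (flip b k false)) / 2.
Proof. by rewrite /= bit_mean_avg. Qed.

Lemma bit_meanD s g h b :
  bit_mean s (fun c => g c + h c) b = bit_mean s g b + bit_mean s h b.
Proof.
elim: s b => // k s IH b; rewrite !bit_mean_cons !IH; lra.
Qed.

Lemma bit_meanZ s a h b :
  bit_mean s (fun c => a * h c) b = a * bit_mean s h b.
Proof. by elim: s b => // k s IH b; rewrite !bit_mean_cons !IH; lra. Qed.

Lemma bit_meanB s g h b :
  bit_mean s (fun c => g c - h c) b = bit_mean s g b - bit_mean s h b.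
Proof. by elim: s b => // k s IH b; rewrite !bit_mean_cons !IH; lra. Qed.

Lemma bit_mean_cst s (a : R) b : bit_mean s (fun=> a) b = a.
Proof. by elim: s b => // k s IH b; rewrite bit_mean_cons !IH; lra. Qed.

Lemma bit_mean_sum (I : Type) (r : seq I) s (F : I -> bit_array -> R) b :
  bit_mean s (fun c => \sum_(i <- r) F i c) b = \sum_(i <- r) bit_mean s (F i) b.
Proof.
elim: r => [|i r IH].
  rewrite big_nil -[RHS](bit_mean_cst s 0 b); congr bit_mean.
  by apply/funext => c; rewrite big_nil.
rewrite big_cons -IH -bit_meanD; congr bit_mean.
by apply/funext => c; rewrite big_cons.
Qed.

Lemma ler_bit_mean s g h b : (forall c, g c <= h c) ->
  bit_mean s g b <= bit_mean s h b.
Proof.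
move=> gh; elim: s b => [b|k s IH b]; first exact: gh.
by rewrite !bit_mean_cons ler_wpM2r ?lerD// invr_ge0.
Qed.

Lemma bit_mean_ge0 s h b : (forall c, 0 <= h c) -> 0 <= bit_mean s h b.
Proof. by move=> h0; rewrite -(bit_mean_cst s 0 b); exact: ler_bit_mean. Qed.

Lemma bit_mean_flip s k v h b : k \notin s ->
  bit_mean s h (flip b k v) = bit_mean s (fun c => h (flip c k v)) b.
Proof.
elim: s b => // l s IH b; rewrite inE negb_or => /andP[kl ks].
by rewrite !bit_mean_cons !(flipC _ _ _ kl) !IH.
Qed.

Lemma bit_mean_cauchy s g h b :
  bit_mean s (fun c => g c * h c) b ^+ 2 <=
  bit_mean s (fun c => g c ^+ 2) b * bit_mean s (fun c => h c ^+ 2) b.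
Proof.
set x := bit_mean _ (fun c => g c * h c) b.
set u := bit_mean _ (fun c => g c ^+ 2) b.
set v := bit_mean _ (fun c => h c ^+ 2) b.
have quad t : 0 <= u - 2 * t * x + t ^+ 2 * v.
  rewrite /u /x /v -!bit_meanZ -bit_meanB -bit_meanD.
  apply: bit_mean_ge0 => c.
  by have := sqr_ge0 (g c - t * h c); rewrite /=; nra.
have u0 : 0 <= u by apply: bit_mean_ge0 => c; exact: sqr_ge0.
have : 0 <= v by apply: bit_mean_ge0 => c; exact: sqr_ge0.
rewrite le_eqVlt => /predU1P[v0|v0].
  have [->|x0] := eqVneq x 0; first by rewrite expr0n/= mulr_ge0// -v0.
  (* With v = 0 the polynomial in [t] is affine; this [t] would give it the value -1. *)
  have := quad ((u + 1) / (2 * x)); rewrite -v0 mulr0 addr0.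
  have -> : 2 * ((u + 1) / (2 * x)) * x = u + 1 by field.
  lra.
have := quad (x / v).
have -> : u - 2 * (x / v) * x + (x / v) ^+ 2 * v = (u * v - x ^+ 2) / v.
  by field; rewrite gt_eqF.
by rewrite pmulr_lge0 ?invr_gt0// subr_ge0.
Qed.

Lemma bit_mean_sqr_le s h b :
  bit_mean s h b ^+ 2 <= bit_mean s (fun c => h c ^+ 2) b.
Proof.
have := bit_mean_cauchy s (fun=> 1) h b; rewrite expr1n bit_mean_cst mul1r.
by congr (_ ^+ 2 <= _); congr bit_mean; apply/funext => c; rewrite mul1r.
Qed.

(** Pythagoras for the splitting of [h] into its average over [k] and the part that is plus or minus
    [half_diff k h]. *)
Lemma bit_avg_sqr k h :
  bit_avg k (fun c => h c ^+ 2) = (fun c => bit_avg k h c ^+ 2 + half_diff k h c ^+ 2).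
Proof. apply/funext => b; rewrite /bit_avg /half_diff; by field. Qed.

Lemma bit_diff_flip k h b v :
  bit_diff k h (flip b k v) = if v then half_diff k h b else - half_diff k h b.
Proof.
by rewrite /bit_diff /half_diff /bit_avg !flip_id; case: v; lra.
Qed.

Lemma bit_avg_diff_sqr k h :
  bit_avg k (fun c => bit_diff k h c ^+ 2) = fun c => half_diff k h c ^+ 2.
Proof. apply/funext => b; rewrite {1}/bit_avg !bit_diff_flip; by field. Qed.

Lemma bit_avg_diff_norm k h :
  bit_avg k (fun c => `|bit_diff k h c|) = fun c => `|half_diff k h c|.
Proof.
apply/funext => b; rewrite {1}/bit_avg !bit_diff_flip normrN; lra.
Qed.

Lemma bit_diff_avgC k l h : bit_avg k (bit_diff l h) = bit_diff l (bit_avg k h).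
Proof.
apply/funext => b; rewrite /bit_diff bit_avgC /bit_avg; lra.
Qed.

Lemma half_diffC k l h : k != l ->
  half_diff k (bit_diff l h) = bit_diff l (half_diff k h).
Proof.
move=> kl; apply/funext => b; rewrite /half_diff /bit_diff /bit_avg.
rewrite !(flipC _ _ _ kl).
lra.
Qed.

(* Induction on the bits: the two-point inequality is applied to the [L^2] norms
   of [h] on the two halves of the cube, whose difference is at most the norm of
   the difference by Cauchy-Schwarz. *)
Lemma bit_mean_log_sobolev s h b : uniq s ->
  bit_mean s (fun c => h c ^+ 2 * ln (h c ^+ 2)) b <=
  2 * (\sum_(k <- s) bit_mean s (fun c => bit_diff k h c ^+ 2) b) +
  bit_mean s (fun c => h c ^+ 2) b * ln (bit_mean s (fun c => h c ^+ 2) b).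
Proof.
elim: s b => [b _|k s IH b]; first by rewrite big_nil mulr0 add0r.
rewrite cons_uniq => /andP[ks us].
pose A g v : R := bit_mean s g (flip b k v).
have E g : bit_mean (k :: s) g b = (A g true + A g false) / 2.
  exact: bit_mean_cons.
have IH1 v := IH (flip b k v) us.
rewrite !E big_cons.
(* The factor 1/4 comes from halving the difference. Twice this energy is half of the mean squared
   difference, exactly what the two-point inequality costs once divided by 2. *)
have -> : bit_mean (k :: s) (fun c => bit_diff k h c ^+ 2) b =
   4^-1 * bit_mean s (fun c => (h (flip c k true) - h (flip c k false)) ^+ 2) b.
  rewrite /= bit_avg_diff_sqr -bit_meanZ; congr bit_mean; apply/funext => c.
  by rewrite /half_diff; by field.
have -> : \sum_(j <- s) bit_mean (k :: s) (fun c => bit_diff j h c ^+ 2) b =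
    ((\sum_(j <- s) A (fun c => bit_diff j h c ^+ 2) true) +
    (\sum_(j <- s) A (fun c => bit_diff j h c ^+ 2) false)) / 2.
  by rewrite -big_split mulr_suml; apply: eq_bigr => j _; rewrite E.
have := IH1 true; have := IH1 false.
rewrite -!/(A _ _).
set u1 := A (fun c => h c ^+ 2) true; set u0 := A (fun c => h c ^+ 2) false.
set w := bit_mean s (fun c => (h (flip c k true) - h (flip c k false)) ^+ 2) b.
have u10 : 0 <= u1 by apply: bit_mean_ge0 => c; exact: sqr_ge0.
have u00 : 0 <= u0 by apply: bit_mean_ge0 => c; exact: sqr_ge0.
have := two_point_log_sobolev (sqrtr_ge0 u1) (sqrtr_ge0 u0).
rewrite !sqr_sqrtr//.
have : (Num.sqrt u1 - Num.sqrt u0) ^+ 2 <= w.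
  have -> : w = u1 + u0 - 2 * bit_mean s (fun c => h (flip c k true) * h (flip c k false)) b.
    rewrite /u1 /u0 /A !bit_mean_flip// -bit_meanD -bit_meanZ -bit_meanB.
    by congr bit_mean; apply/funext => c; ring.
  rewrite sqrrB !sqr_sqrtr// -sqrtrM//.
  have : bit_mean s (fun c => h (flip c k true) * h (flip c k false)) b <=
      Num.sqrt (u1 * u0).
    rewrite (le_trans (ler_norm _))// -sqrtr_sqr ler_wsqrtr//.
    rewrite /u1 /u0 /A !bit_mean_flip//; exact: bit_mean_cauchy.
  by rewrite -[_ *+ 2]mulr_natl; lra.
set S1 := \sum_(j <- s) _; set S0 := \sum_(j <- s) _.
lra.
Qed.

End bit_mean.

(** * Entropy bounds and the Falik-Samorodnitsky inequality *)

Section falik_samorodnitsky.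
Context {R : realType}.
Implicit Types (h : bit_array -> R) (s : seq (nat * nat)) (b : bit_array).

(** This is ln y <= y - 1 at y = t / |a|, multiplied by 2 a^2, with equality at |a| = t. The left
    side is linear in a^2 and |a|, so it can be averaged with [t] fixed. *)
Lemma sqr_ln_sqr_ge (a t : R) : 0 < t ->
  a ^+ 2 * ln (t ^+ 2) + 2 * (a ^+ 2 - t * `|a|) <= a ^+ 2 * ln (a ^+ 2).
Proof.
move=> t0; rewrite -[a ^+ 2]real_normK ?num_real//.
have [->|a0] := eqVneq a 0.
  by rewrite normr0 expr0n/= !mul0r mulr0 subrr mulr0 addr0.
have {}a0 : 0 < `|a| by rewrite normr_gt0.
set x := `|a| in a0 *.
have := @le_ln1Dx R (t / x - 1).
rewrite addrCA subrr addr0 ln_div ?posrE// !lnXn// => /(_ _)H.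
have {}H : ln t - ln x <= t / x - 1.
  by apply: H; rewrite ltrBDr addrC subrr divr_gt0.
have : x ^+ 2 * (ln t - ln x) <= x ^+ 2 * (t / x - 1).
  by rewrite ler_pM2l// exprn_gt0.
have -> : x ^+ 2 * (t / x - 1) = t * x - x ^+ 2 by field; rewrite gt_eqF.
by rewrite -[ln t *+ 2]mulr_natl -[ln x *+ 2]mulr_natl; lra.
Qed.

(** The linearised form of Ent(h^2) >= u ln (u / w^2), where u and w are the means of h^2 and |h|:
    at lambda = u / w^2 the two bounds coincide. *)
Lemma bit_mean_entropy_ge s h b (lambda : R) : 0 < lambda ->
  bit_mean s (fun c => h c ^+ 2) b * (1 + ln lambda) -
  lambda * bit_mean s (fun c => `|h c|) b ^+ 2 <=
  bit_mean s (fun c => h c ^+ 2 * ln (h c ^+ 2)) b -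
  bit_mean s (fun c => h c ^+ 2) b * ln (bit_mean s (fun c => h c ^+ 2) b).
Proof.
move=> l0; set u := bit_mean s (fun c => h c ^+ 2) b.
set w := bit_mean s (fun c => `|h c|) b; set e := bit_mean s _ b.
have H t : 0 < t -> u * ln (t ^+ 2) + 2 * (u - t * w) <= e.
  move=> t0; rewrite [u * _]mulrC /u /w -!(bit_meanZ, bit_meanB, bit_meanD).
  apply: ler_bit_mean => c; rewrite [ln (t ^+ 2) * _]mulrC.
  exact: sqr_ln_sqr_ge.
have w0 : 0 <= w by apply: bit_mean_ge0.
have : 0 <= u by apply: bit_mean_ge0 => c; exact: sqr_ge0.
rewrite le_eqVlt => /predU1P[u0|u0].
  have w20 : w = 0.
    apply/eqP; rewrite -sqrf_eq0 eq_le sqr_ge0 andbT u0.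
    rewrite (le_trans (bit_mean_sqr_le _ _ _))//.
    by rewrite le_eqVlt; apply/orP; left; apply/eqP; congr bit_mean;
      apply/funext => c; rewrite real_normK// num_real.
  by have := H 1 ltr01; rewrite -u0 w20; lra.
have ul : 0 < u * lambda by rewrite mulr_gt0.
(* With this [t], the claim becomes the square of [sqrt u - sqrt lambda * w]. *)
have := H (Num.sqrt (u * lambda)); rewrite sqrtr_gt0 ul => /(_ isT).
rewrite (sqr_sqrtr (ltW ul)) (lnM u0 l0).
have := sqr_ge0 (Num.sqrt u - Num.sqrt lambda * w).
rewrite sqrrB exprMn (sqr_sqrtr (ltW u0)) (sqr_sqrtr (ltW l0)).
rewrite (sqrtrM _ (ltW u0)) -[_ *+ 2]mulr_natl.
lra.
Qed.

(* Along the first bit, [h] is its average plus or minus [half_diff k h], and both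
   the variance and the energy add up. *)
Theorem falik_samorodnitsky s h b (lambda : R) : uniq s -> 0 < lambda ->
  (bit_mean s (fun c => h c ^+ 2) b - bit_mean s h b ^+ 2) * (1 + ln lambda) -
  lambda * (\sum_(k <- s) bit_mean s (fun c => `|bit_diff k h c|) b ^+ 2) <=
  2 * (\sum_(k <- s) bit_mean s (fun c => bit_diff k h c ^+ 2) b).
Proof.
move=> + l0; elim: s h => [h _|k s IH h].
  by rewrite !big_nil/= subrr mul0r !mulr0 subrr.
rewrite cons_uniq => /andP[ks us]; rewrite !big_cons.
have {IH} := IH (bit_avg k h) us.
have := @bit_mean_entropy_ge s (half_diff k h) b _ l0.
have := @bit_mean_log_sobolev _ s (half_diff k h) b us.
set D := half_diff k h; set H := bit_avg k h => /=.
rewrite bit_avg_sqr bit_avg_diff_sqr bit_avg_diff_norm -/D -/H bit_meanD.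
have -> : \sum_(j <- s) bit_mean s (bit_avg k (fun c => bit_diff j h c ^+ 2)) b =
    \sum_(j <- s) bit_mean s (fun c => bit_diff j H c ^+ 2) b +
    \sum_(j <- s) bit_mean s (fun c => bit_diff j D c ^+ 2) b.
  rewrite -big_split; apply: eq_big_seq => j js.
  have kj : k != j by apply: contraNneq ks => ->.
  rewrite bit_avg_sqr bit_meanD bit_diff_avgC half_diffC//.
set SD := \sum_(j <- s) _; set SN := \sum_(j <- s) _.
set u := bit_mean s (fun c => D c ^+ 2) b.
set A := \sum_(j <- s) _; set B := \sum_(j <- s) _.
(* Averaging over [k] contracts the first moments of the other differences; their squares are
   subtracted with weight [lambda], so this is the favourable direction. *)
have : SN <= B.
  apply: ler_sum => j _.
  rewrite ler_pXn2r ?nnegrE ?bit_mean_ge0//; last first.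
    by move=> c; rewrite /bit_avg divr_ge0// addr_ge0.
  apply: ler_bit_mean => c; rewrite -bit_diff_avgC /bit_avg normrM.
  by rewrite [X in _ * X]ger0_norm ?invr_ge0// ler_pM2r ?invr_gt0// ler_normD.
rewrite -(ler_pM2l l0).
(* The energy of the bit [k] itself is left over on the right side, and only its sign matters. *)
have : 0 <= u by apply: bit_mean_ge0 => c; exact: sqr_ge0.
set v := bit_mean s _ b; set w := bit_mean s _ b; set x := bit_mean s _ b.
set z := bit_mean s _ b.
lra.
Qed.

End falik_samorodnitsky.

(** * The product measure on the cube *)

Section cube_measure.
Context {R : realType}.

Definition cube_box (n : nat) (A : nat -> set R) : set (cube R) :=
  [set y | forall j, (j <= n)%N -> A j (y j)%:num].

Lemma measurable_coord (j : nat) :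
  measurable_fun setT (fun y : cube R => (y j)%:num : R).
Proof.
move=> _ A mA; rewrite setTI; apply: sub_sigma_algebra.
by exists j, A.
Qed.

Lemma measurable_cubeP d (T : measurableType d) (F : T -> cube R) :
  (forall j, measurable_fun setT (fun w => (F w j)%:num : R)) ->
  measurable_fun setT F.
Proof.
move=> mF; apply: (@measurability _ _ T (cube R) setT F (@cylinders R) erefl).
move=> _ [_ [j [A mA ->]] <-].
exact: mF.
Qed.

Lemma measurable_finite_forall d (T : measurableType d) (n : nat)
    (E : nat -> set T) : (forall j, measurable (E j)) ->
  measurable [set w | forall j, (j <= n)%N -> E j w].
Proof.
move=> mE.
have -> : [set w | forall j, (j <= n)%N -> E j w] =
    \bigcap_j (if (j <= n)%N then E j else setT).
  apply/seteqP; split => [w H j _|w H j jn].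
    by case: ifPn => // jn; exact: H.
  by have := H j I; rewrite jn.
by apply: bigcapT_measurable => j; case: ifP.
Qed.

Lemma measurable_cube_box n A : (forall j, measurable (A j)) ->
  measurable (cube_box n A).
Proof.
move=> mA; apply: measurable_finite_forall => j.
by rewrite -[X in measurable X]setTI; exact: measurable_coord.
Qed.

(** The bound [n0] does not change the generated sigma-algebra, because sides may be [setT]. It lets
    a box be cut at any prescribed index. *)
Definition cube_boxes (n0 : nat) : set (set (cube R)) :=
  [set B | exists n, exists2 A : nat -> set R,
    (n0 <= n)%N /\ (forall j, measurable (A j)) & B = cube_box n A].

Lemma cube_boxesT n0 : cube_boxes n0 setT.
Proof. by exists n0, (fun=> setT) => //; apply/seteqP; split. Qed.

Lemma measurable_cube_boxesE n0 : measurable = <<s cube_boxes n0 >>.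
Proof.
rewrite eqEsubset; split; apply: smallest_sub.
- exact: smallest_sigma_algebra.
- move=> _ [j [A mA ->]]; apply: sub_sigma_algebra.
  exists (maxn n0 j), (fun i => if i == j then A else setT).
    by split=> [|i]; [exact: leq_maxl|case: ifP].
  apply/seteqP; split => [y Ay i _|y Ay] /=; first by case: eqP => // ->.
  by have := Ay j (leq_maxr _ _); rewrite eqxx.
- exact: sigma_algebra_measurable.
- by move=> _ [n [A [_ mA] ->]]; exact: measurable_cube_box.
Qed.

Lemma setI_cube_boxes n0 : setI_closed (cube_boxes n0).
Proof.
move=> _ _ [n [A [n0n mA] ->]] [n' [A' [_ mA'] ->]].
exists (maxn n n'), (fun i => (if (i <= n)%N then A i else setT) `&`
   (if (i <= n')%N then A' i else setT)).
  split=> [|i]; first by rewrite (leq_trans n0n)// leq_maxl.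
  by apply: measurableI; case: ifP.
apply/seteqP; split => [y [yA yA'] i|y yA].
  by move=> _; split; case: ifP; [exact: yA| |exact: yA'|].
split=> i ni.
  by have := yA i (leq_trans ni (leq_maxl _ _)); rewrite ni => -[].
by have := yA i (leq_trans ni (leq_maxr _ _)); rewrite ni => -[].
Qed.

Lemma cube_measure_ext (n0 : nat) (m1 m2 : {measure set (cube R) -> \bar R}) :
  (m1 setT < +oo)%E ->
  (forall n A, (n0 <= n)%N -> (forall j, measurable (A j)) ->
    m1 (cube_box n A) = m2 (cube_box n A)) ->
  forall B, measurable B -> m1 B = m2 B.
Proof.
move=> m1oo m12; apply: (measure_unique (cube_boxes n0) (fun=> setT)) => //.
- exact: measurable_cube_boxesE.
- exact: setI_cube_boxes.
- by move=> _; exact: cube_boxesT.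
- by rewrite bigcup_const//; exists 0%N.
- by move=> _ [n [A [n0n mA] ->]]; exact: m12.
Qed.

Lemma splice_lt d (y : 'I_d -> {i01 R}) z j (jd : (j < d)%N) :
  splice y z j = y (Ordinal jd).
Proof.
rewrite /splice; case: insubP => [k _ kj|]; last by rewrite jd.
by congr y; apply: val_inj.
Qed.

Lemma splice_ge d (y : 'I_d -> {i01 R}) z j : (d <= j)%N ->
  splice y z j = z (j - d)%N.
Proof. by move=> dj; rewrite /splice insubN// -leqNgt. Qed.

Lemma measurable_splice2 d (T : measurableType d) (c : nat)
    (Y : T -> 'I_c -> {i01 R}) (Z : T -> cube R) :
  (forall k, measurable_fun setT (fun w => (Y w k)%:num : R)) ->
  measurable_fun setT Z ->
  measurable_fun setT (fun w => splice (Y w) (Z w)).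
Proof.
move=> mY mZ; apply: measurable_cubeP => j.
have [jc|cj] := ltnP j c.
  by apply: eq_measurable_fun (mY (Ordinal jc)) => w _; rewrite splice_lt.
apply: (eq_measurable_fun (fun w => (Z w (j - c)%N)%:num)) => [w _|].
  by rewrite splice_ge.
exact: measurableT_comp (measurable_coord _) mZ.
Qed.

Lemma measurable_splice c (y : 'I_c -> {i01 R}) :
  measurable_fun setT (fun z : cube R => splice y z : cube R).
Proof. by apply: measurable_splice2. Qed.

Definition cube_head (d : nat) (y : cube R) : 'I_d -> {i01 R} := fun k => y k.

Lemma measurable_splice_head d :
  measurable_fun setT (fun p : cube R * cube R =>
    splice (@cube_head d p.1) p.2 : cube R).
Proof.
apply: measurable_splice2 => // k.
exact: measurableT_comp (measurable_coord _) measurable_fst.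
Qed.

Lemma unit_itv_prob : lebesgue_measure (setT `&` `[0%R, 1%R] : set R) = 1%E.
Proof. by rewrite setTI lebesgue_measure_itv/= lte_fin ltr01 sube0. Qed.

Variable lam : probability (cube R) R.
Hypothesis lamP : is_lebesgue_product lam.

Lemma lam_box n A : (forall j, measurable (A j)) ->
  lam (cube_box n A) = (\prod_(j < n.+1) lebesgue_measure (A j `&` `[0%R, 1%R]))%E.
Proof. exact: lamP. Qed.

(** It is enough to test boxes with at least d sides. Such a box pulls back to the product of a box
    on the first d coordinates and a shifted box, and the sides that become free contribute a factor
    1. *)
Lemma splice_product_measure d B : measurable B ->
  (lam \x lam)%E [set p : cube R * cube R | B (splice (@cube_head d p.1) p.2)] =
  lam B.
Proof.
pose phi (p : cube R * cube R) : cube R := splice (@cube_head d p.1) p.2.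
have mphi : measurable_fun setT phi by exact: measurable_splice_head.
apply: (@cube_measure_ext d (pushforward (lam \x lam)%E phi) lam) => //.
  have lamXT : (lam \x lam)%E (setT `*` setT) = 1%E.
    transitivity (lam setT * lam setT)%E; first exact: product_measure1E.
    by rewrite probability_setT mule1.
  by rewrite /= /pushforward preimage_setT -setXTT lamXT ltry.
move=> n A dn mA; rewrite /= /pushforward.
have -> : phi @^-1` cube_box n A =
    cube_box n (fun j => if (j < d)%N then A j else setT) `*`
    cube_box (n - d) (fun j => A (d + j)%N).
  apply/seteqP; split => -[y z]/=.
    move=> H; split => j jn /=.
      by case: ifPn => // jd; have := H j jn; rewrite /phi splice_lt.
    have := H (d + j)%N; rewrite /phi splice_ge ?leq_addr// addKn; apply.
    by rewrite -leq_subRL.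
  move=> [yA zA] j jn; rewrite /phi; have [jd|dj] := ltnP j d.
    by have := yA _ jn; rewrite jd splice_lt.
  rewrite splice_ge//; have := zA (j - d)%N; rewrite subnKC//; apply.
  exact: leq_sub2r.
have mA' j : measurable (if (j < d)%N then A j else setT) by case: ifP.
transitivity (lam (cube_box n (fun j => if (j < d)%N then A j else setT)) *
    lam (cube_box (n - d) (fun j => A (d + j)%N)))%E.
  by apply: product_measure1E; exact: measurable_cube_box.
rewrite (lam_box _ mA') (lam_box _ (fun j => mA (d + j)%N)) (lam_box _ mA).
rewrite -(subnKC dn) addKn -addnS !big_split_ord/=.
rewrite [X in (_ * X * _)%E]big1 ?mule1; last first.
  by move=> j _; rewrite ltnNge leq_addr/= unit_itv_prob.
congr (_ * _)%E; apply: eq_bigr => j _.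
by rewrite ltn_ord.
Qed.

(** The outer variable ranges over the whole cube although only its first d coordinates are read;
    this dispenses with a measure on the finite-dimensional cube. *)
Lemma splice_tonelli (d : nat) (h : cube R -> \bar R) :
  measurable_fun setT h -> (forall y, 0 <= h y)%E ->
  (\int[lam]_y h y = \int[lam]_y \int[lam]_z h (splice (@cube_head d y) z))%E.
Proof.
move=> mh h0.
pose phi (p : cube R * cube R) : cube R := splice (@cube_head d p.1) p.2.
have mphi : measurable_fun setT phi by exact: measurable_splice_head.
rewrite (eq_measure_integral (pushforward (lam \x lam)%E phi)); last first.
  by move=> A mA _; exact/esym/splice_product_measure.
rewrite ge0_integral_pushforward//.
rewrite preimage_setT fubini_tonelli1//.
  exact: measurableT_comp mh mphi.
by move=> p; exact: h0.
Qed.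

Lemma measurable_splice_tonelli (d : nat) (h : cube R -> \bar R) :
  measurable_fun setT h -> (forall y, 0 <= h y)%E ->
  measurable_fun setT
    (fun y => \int[lam]_z h (splice (@cube_head d y) z))%E.
Proof.
move=> mh h0.
apply: (@measurable_fun_fubini_tonelli_F _ _ _ _ _ lam
  (fun p => h (splice (@cube_head d p.1) p.2))) => //.
exact: measurableT_comp mh (measurable_splice_head _).
Qed.

End cube_measure.

(** * Binary expansions of random bits *)

Section binary_expansion.
Context {R : realType}.

Lemma dyadicS (b : nat -> bool) m :
  dyadic R b m.+1 = dyadic R b m + (b m.+1)%:R / 2 ^+ m.+1.
Proof. by rewrite /dyadic big_nat_recr. Qed.

Lemma eq_dyadic (b c : nat -> bool) m :
  (forall i, (1 <= i <= m)%N -> b i = c i) -> dyadic R b m = dyadic R c m.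
Proof. by move=> bc; apply: eq_big_nat => i im; rewrite bc. Qed.

Lemma exprV2S m : 2^-1 ^+ m = 2 * 2^-1 ^+ m.+1 :> R.
Proof. by rewrite exprS; field. Qed.

(** The subtracted term 2^-(m+k) is what makes the induction on [k] close; the bound on the limit
    follows by dropping it. *)
Lemma dyadicD_le b m k :
  dyadic R b (m + k) <= dyadic R b m + 2^-1 ^+ m - 2^-1 ^+ (m + k).
Proof.
elim: k => [|k IH]; first by rewrite addn0; lra.
rewrite addnS dyadicS -exprVn.
have := exprV2S (m + k); have : 0 <= 2^-1 ^+ (m + k).+1 :> R.
  by rewrite exprn_ge0// invr_ge0.
by case: (b _); move: IH; set x := 2^-1 ^+ (m + k).+1 => /=; lra.
Qed.

Lemma dyadic_nd b m k : dyadic R b m <= dyadic R b (m + k).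
Proof.
elim: k => [|k IH]; first by rewrite addn0.
by rewrite addnS dyadicS (le_trans IH)// lerDl divr_ge0// exprn_ge0.
Qed.

Lemma dyadic_le_binary b m : dyadic R b m <= binary R b.
Proof.
apply: limr_ge; first exact: is_cvg_dyadic.
by exists m => // k /= /subnKC <-; exact: dyadic_nd.
Qed.

Lemma binary_le_dyadic b m : binary R b <= dyadic R b m + 2^-1 ^+ m.
Proof.
apply: limr_le; first exact: is_cvg_dyadic.
exists m => // k /= /subnKC <-; apply: le_trans (dyadicD_le _ _ _) _.
by rewrite gerBl exprn_ge0// invr_ge0.
Qed.

Definition column (j m : nat) : seq (nat * nat) :=
  [seq (i, j) | i <- index_iota 1 m.+1].

(** Enumerated with [j] outside, so that a sum over this list is the double sum in N_p, and one more
    column is appended at the end. *)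
Definition columns (d m : nat) : seq (nat * nat) :=
  [seq (i, j) | j <- index_iota 0 d, i <- index_iota 1 m.+1].

Lemma columnS j m : column j m.+1 = rcons (column j m) (m.+1, j).
Proof.
rewrite /column /index_iota (_ : m.+2 - 1 = m.+1 - 1 + 1)%N; last lia.
by rewrite iotaD map_cat -cats1 subn1.
Qed.

Lemma columnsS d m : columns d.+1 m = columns d m ++ column d m.
Proof.
by rewrite /columns /index_iota !subn0 -[d.+1 in LHS]addn1 iotaD allpairs_cat /= cats0.
Qed.

Lemma mem_column j m k : (k \in column j m) = (1 <= k.1 <= m)%N && (k.2 == j).
Proof.
apply/mapP/idP => [[i im ->]|].
  by move: im; rewrite mem_index_iota ltnS => ->/=.
case: k => i j' /= /andP[im /eqP ->]; exists i => //.
by rewrite mem_index_iota ltnS.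
Qed.

Lemma mem_columns d m k : (k \in columns d m) = (1 <= k.1 <= m)%N && (k.2 < d)%N.
Proof.
apply/allpairsP/idP => [[[j i] [/= jd im ->]]|].
  by move: jd im; rewrite !mem_index_iota /= !ltnS => -> ->.
case: k => i j /= /andP[im jd]; exists (j, i) => /=.
by rewrite !mem_index_iota ltnS.
Qed.

Lemma uniq_column j m : uniq (column j m).
Proof. by rewrite map_inj_uniq ?iota_uniq// => ? ? []. Qed.

Lemma uniq_columns d m : uniq (columns d m).
Proof. by rewrite allpairs_uniq ?iota_uniq// => -[? ?] [? ?] _ _ [-> ->]. Qed.

Lemma bit_mean_cat (s t : seq (nat * nat)) (h : bit_array -> R) :
  bit_mean (s ++ t) h = bit_mean t (bit_mean s h).
Proof. by elim: s h => //= k s IH h. Qed.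

Lemma bit_mean_rcons (s : seq (nat * nat)) k (h : bit_array -> R) :
  bit_mean (rcons s k) h = bit_mean s (bit_avg k h).
Proof. by rewrite -cats1 bit_mean_cat /= bit_mean_avg. Qed.

Lemma sum_double n (F : nat -> R) :
  \sum_(0 <= k < n.*2) F k = \sum_(0 <= k < n) (F k.*2 + F k.*2.+1).
Proof.
elim: n => [|n IH]; first by rewrite !big_geq.
by rewrite doubleS big_nat_recr// big_nat_recr//= IH big_nat_recr//= addrA.
Qed.

(** The truncated expansion is uniform on the grid of step 2^-m. Averaging over the last bit
    replaces [phi] by [psi], which pairs the grid points of indices 2k and 2k + 1. *)
Lemma bit_mean_column j m (phi : R -> R) b :
  bit_mean (column j m) (fun c => phi (dyadic R (c ^~ j) m)) b =
  2^-1 ^+ m * \sum_(0 <= k < 2 ^ m) phi (k%:R / 2 ^+ m).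
Proof.
elim: m phi => [|m IH] phi.
  by rewrite /= expr0 expn0 big_nat1 mul1r mul0r /dyadic big_geq.
rewrite columnS bit_mean_rcons.
pose psi u := (phi (u + 1 / 2 ^+ m.+1) + phi u) / 2.
rewrite (_ : bit_avg _ _ = fun c => psi (dyadic R (c ^~ j) m)); last first.
  apply/funext => c; rewrite /bit_avg /psi; congr ((phi _ + phi _) / 2).
    rewrite dyadicS (flipE _ _ _ (m.+1, j)) eqxx; congr (_ + _).
    apply: eq_dyadic => i im; rewrite (flipE _ _ _ (i, j)) xpair_eqE.
    by rewrite ltn_eqF// ltnS; case/andP: im.
  rewrite dyadicS (flipE _ _ _ (m.+1, j)) eqxx mul0r addr0.
  apply: eq_dyadic => i im; rewrite (flipE _ _ _ (i, j)) xpair_eqE.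
  by rewrite ltn_eqF// ltnS; case/andP: im.
rewrite (IH psi) expnS mul2n sum_double exprV2S -mulrA mulrCA mulr_sumr.
congr (_ * _); apply: eq_bigr => k _; rewrite /psi.
have p0 : 2 ^+ m.+1 != 0 :> R by rewrite expf_neq0.
rewrite -muln2 natrM -[(_ * 2).+1%:R]natr1 natrM addrC.
have -> : k%:R * 2 / 2 ^+ m.+1 = k%:R / 2 ^+ m :> R.
  by rewrite exprS; field; rewrite expf_neq0.
have -> : (k%:R * 2 + 1) / 2 ^+ m.+1 = k%:R / 2 ^+ m + 1 / 2 ^+ m.+1 :> R.
  by rewrite exprS; field; rewrite expf_neq0.
by field.
Qed.

Lemma clampD_le (u e : R) : 0 <= e ->
  Num.max 0 (Num.min (u + e) 1) <= Num.max 0 (Num.min u 1) + e.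
Proof.
move=> e0; have c0 : 0 <= Num.max 0 (Num.min u 1) by rewrite le_max lexx.
rewrite ge_max addr_ge0//= -lerBlDr; apply: (@le_trans _ _ (Num.min u 1)).
  by rewrite le_min !lerBlDr !ge_min lexx/= lerDl e0 orbT.
by rewrite le_max lexx orbT.
Qed.

(** After rescaling by 2^-m with n = 2^m, the two bounds are the lengths of the parts of [0,1] below
    a point and below its translate by 2^-m. *)
Lemma count_lt_bounds (x : R) n :
  Num.max 0 (Num.min x n%:R) <= \sum_(0 <= k < n) (k%:R < x)%R%:R <=
  Num.max 0 (Num.min (x + 1) n%:R).
Proof.
elim: n => [|n /andP[IH1 IH2]].
  by rewrite big_geq//; apply/andP; split; rewrite /Num.max /Num.min;
    repeat case: ifPn => //; rewrite -?leNgt; lra.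
rewrite big_nat_recr//= -[n.+1%:R]natr1.
have n0 : 0 <= n%:R :> R by [].
move: IH1 IH2; set c := \sum_(0 <= k < n) _ => IH1 IH2.
have [nx|xn] := ltP n%:R x; rewrite ?(mulr1n, mulr0n) ?addr0.
  have nc : n%:R <= c.
    by apply: le_trans IH1; rewrite le_max le_min lexx (ltW nx) orbT.
  have cn : c <= n%:R by apply: le_trans IH2 _; rewrite ge_max n0/= ge_min lexx orbT.
  rewrite ge_max le_max le_min !lerD2r (le_trans cn (ltW nx)) cn orbT andbT.
  by rewrite (addr_ge0 (le_trans n0 nc) ler01)/= ge_min lerD2r nc orbT.
apply/andP; split.
  apply: le_trans IH1; rewrite ge_max !le_max lexx/=.
  by rewrite le_min !ge_min lexx xn orbT.
apply: le_trans IH2 _; rewrite ge_max !le_max lexx/=; apply/orP; right.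
by rewrite le_min !ge_min lexx/= lerDl ler01 orbT.
Qed.

End binary_expansion.

(** * Joint probabilities of finitely many bits *)

Section random_bits.
Context d (T : measurableType d) (R : realType) (P : probability T R).
Variable x : nat -> nat -> {RV P >-> bool}.
Hypothesis xP : iid_symmetric_bits x.
Implicit Types (s t : seq (nat * nat)) (b c : bit_array).

Definition bit_cylinder t b : set T :=
  [set w | forall k, k \in t -> bits x w k.1 k.2 = b k.1 k.2].

Lemma measurable_bit_eq (k : nat * nat) v : measurable [set w | x k.1 k.2 w = v].
Proof.
by rewrite -[X in measurable X]setTI;
  exact: (@measurable_funPT _ _ _ _ (x k.1 k.2) measurableT [set v]).
Qed.

Lemma bit_cylinder_nil b : bit_cylinder [::] b = setT.
Proof. by apply/seteqP; split. Qed.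

Lemma bit_cylinder_cons k t b : bit_cylinder (k :: t) b =
  [set w | x k.1 k.2 w = b k.1 k.2] `&` bit_cylinder t b.
Proof.
apply/seteqP; split => w.
  move=> H; split; first by apply: H; rewrite mem_head.
  by move=> l lt; apply: H; rewrite inE lt orbT.
by move=> [Hk H] l; rewrite inE => /predU1P[->//|]; exact: H.
Qed.

Lemma measurable_bit_cylinder t b : measurable (bit_cylinder t b).
Proof.
elim: t => [|k t IH]; first by rewrite bit_cylinder_nil.
by rewrite bit_cylinder_cons; apply: measurableI => //; exact: measurable_bit_eq.
Qed.

Lemma prob_bit_cylinder t b : uniq t -> all (fun k => 1 <= k.1)%N t ->
  P (bit_cylinder t b) = (2^-1 ^+ size t)%:E.
Proof.
move=> ut /allP t1; case: xP => ind dis.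
have := ind t (fun k => [set b k.1 k.2]) ut t1 (fun _ => I).
rewrite [X in P X](_ : _ = bit_cylinder t b)//.
move=> ->; rewrite (eq_big_seq (fun=> (2^-1)%:E)); last first.
  move=> k /t1 k1; have := dis k.1 k.2 k1 [set b k.1 k.2].
  rewrite /distribution /pushforward => ->.
  rewrite bernoulli_probE ?divr_ge0 ?ler01//; last by lra.
  rewrite !diracE/= !in_set1 /unstable.onem; case: (b _ _).
    by rewrite mule0 adde0 mule1.
  by rewrite mule0 add0e mule1; congr EFin; field.
rewrite big_const_seq count_predT; elim: (size t) => //= n ->.
by rewrite -EFinM exprS.
Qed.

Lemma bit_cylinder_split k t b (E : set T) : k \notin t ->
  bit_cylinder t b `&` E =
  (bit_cylinder (k :: t) (flip b k true) `&` E) `|`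
  (bit_cylinder (k :: t) (flip b k false) `&` E).
Proof.
move=> kt.
have H v : bit_cylinder (k :: t) (flip b k v) =
    [set w | x k.1 k.2 w = v] `&` bit_cylinder t b.
  rewrite bit_cylinder_cons flipE eqxx; congr (_ `&` _).
  apply/seteqP; split => w H l lt; have := H l lt; rewrite flipE;
    by case: eqP => // lk; rewrite -lk lt in kt.
rewrite !H -setIUl -setIUl; congr (_ `&` _).
apply/seteqP; split => w; last by case.
by move=> Hw; split => //; case E1 : (x k.1 k.2 w); [left|right].
Qed.

Lemma bit_cylinder_disj k t b (E : set T) :
  [disjoint (bit_cylinder (k :: t) (flip b k true) `&` E) &
  (bit_cylinder (k :: t) (flip b k false) `&` E)].
Proof.
rewrite disj_set2E; apply/eqP/seteqP; split => // w [[H1 _] [H2 _]].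
have := H1 k (mem_head _ _); have := H2 k (mem_head _ _).
by rewrite !flipE eqxx => ->.
Qed.

Definition depends_on (V : Type) s (h : bit_array -> V) :=
  forall b c, (forall k, k \in s -> b k.1 k.2 = c k.1 k.2) -> h b = h c.

Lemma bit_cylinder_depends (V : Type) t b (h : bit_array -> V) w :
  depends_on t h -> bit_cylinder t b w -> h (bits x w) = h b.
Proof. by move=> th wt; apply: th. Qed.

(** [B] is an event of probability [q] independent of the bits selected by [adm]. By induction each
    bit of [s] passes from the mean into the cylinder; when [s] is empty, [phi] is constant on the
    cylinder. *)
Lemma prob_bit_event (adm : pred (nat * nat)) (B : set T) (q : R) :
  measurable B ->
  (forall t b, uniq t -> all adm t ->
    P (bit_cylinder t b `&` B) = (2^-1 ^+ size t * q)%:E) ->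
  forall s t b (phi : bit_array -> bool), uniq (s ++ t) -> all adm (s ++ t) ->
  depends_on (s ++ t) phi ->
  measurable (bit_cylinder t b `&` (B `&` [set w | phi (bits x w)])) /\
  P (bit_cylinder t b `&` (B `&` [set w | phi (bits x w)])) =
  (2^-1 ^+ size t * q * bit_mean s (fun c => (phi c)%:R) b)%:E.
Proof.
move=> mB PB; elim=> [|k s IH] t b phi.
  move=> /= ut at_ phit.
  have [phib|phib] := boolP (phi b).
    have -> : bit_cylinder t b `&` (B `&` [set w | phi (bits x w)]) =
        bit_cylinder t b `&` B.
      apply/seteqP; split => w [wt]; first by case.
      by move=> wB; split => //; split => //=; rewrite (bit_cylinder_depends phit wt).
    split; first by apply: measurableI => //; exact: measurable_bit_cylinder.
    by rewrite PB// mulr1.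
  have -> : bit_cylinder t b `&` (B `&` [set w | phi (bits x w)]) = set0.
    apply/seteqP; split => // w [wt [_]] /=.
    by rewrite (bit_cylinder_depends phit wt) (negbTE phib).
  by rewrite measure0 mulr0.
rewrite cat_cons /= => /andP[kst ust] /andP[ak ast] phist.
have kt : k \notin t by move: kst; rewrite mem_cat negb_or => /andP[].
have skt : perm_eq (s ++ k :: t) (k :: s ++ t) := permEl (perm_catCA s [:: k] t).
have u' : uniq (s ++ k :: t) by rewrite (perm_uniq skt) /= kst.
have a' : all adm (s ++ k :: t) by rewrite (perm_all _ skt) /= ak.
have d' : depends_on (s ++ k :: t) phi.
  by move=> c c' cc'; apply: phist => l ls; apply: cc'; rewrite (perm_mem skt).
have [m1 P1] := IH (k :: t) (flip b k true) phi u' a' d'.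
have [m0 P0] := IH (k :: t) (flip b k false) phi u' a' d'.
rewrite (bit_cylinder_split _ _ kt); split; first exact: measurableU.
set E1 := _ `&` _ in m1 P1 *; set E0 := bit_cylinder _ (flip b k false) `&` _ in m0 P0 *.
transitivity (P E1 + P E0)%E.
  apply: measureU => //; apply/eqP; rewrite -disj_set2E; exact: bit_cylinder_disj.
rewrite P1 P0 -EFinD -[bit_mean s (bit_avg k _) b]/(bit_mean (k :: s) _ b).
by rewrite bit_mean_cons /= exprS; congr EFin; field.
Qed.

End random_bits.

Section measurable_bits.
Context d (T : measurableType d) (R : realType).

Lemma measurable_dyadic (b : T -> nat -> bool) m :
  (forall i, measurable_fun setT (fun w => b w i)) ->
  measurable_fun setT (fun w => dyadic R (b w) m).
Proof.
move=> mb; apply: measurable_sum => i.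
apply: measurable_funM => //.
have mnat : measurable_fun setT (fun v : bool => v%:R : R) by [].
exact: measurableT_comp mnat (mb i).
Qed.

Lemma measurable_binary (b : T -> nat -> bool) :
  (forall i, measurable_fun setT (fun w => b w i)) ->
  measurable_fun setT (fun w => binary R (b w)).
Proof.
move=> mb.
apply: (@measurable_fun_cvg _ _ _ _ (fun m w => dyadic R (b w) m)).
  by move=> m; exact: measurable_dyadic.
by move=> w _; exact: is_cvg_dyadic.
Qed.

Lemma measurable_Xseq m n (b : T -> bit_array) :
  (forall i j, measurable_fun setT (fun w => b w i j)) ->
  measurable_fun setT (fun w => Xseq R m n (b w)).
Proof.
move=> mb; apply: measurable_cubeP => j; rewrite /Xseq.
have [jn|jn] := leqP j n.
  exact: (@measurable_dyadic (fun w i => b w i j)).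
exact: (@measurable_binary (fun w i => b w i j)).
Qed.

Lemma measurable_flip (b : T -> bit_array) k v :
  (forall i j, measurable_fun setT (fun w => b w i j)) ->
  forall i j, measurable_fun setT (fun w => flip (b w) k v i j).
Proof.
move=> mb i j; rewrite /flip /set_bit.
by have [_|_] := boolP ((i == k.1) && (j == k.2)).
Qed.

End measurable_bits.

Lemma lebesgue_unit_ray (R : realType) (u : R) :
  lebesgue_measure (`]-oo, u[ `&` `[0, 1]) = (Num.max 0 (Num.min u 1))%:E.
Proof.
have [u0|u0] := leP u 0.
  rewrite (_ : _ `&` _ = set0); last first.
    apply/seteqP; split => // y /=; rewrite !in_itv/= => -[yu /andP[y0 _]].
    by move: yu; rewrite ltNge (le_trans u0).
  rewrite measure0 /Num.max /Num.min; congr EFin.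
  by repeat case: ifPn; rewrite -?leNgt; lra.
have [u1|u1] := leP u 1.
  rewrite (_ : _ `&` _ = `[0, u[%classic); last first.
    apply/seteqP; split => y /=; rewrite !in_itv/=.
      by move=> [-> /andP[-> _]].
    by move=> /andP[-> yu]; split => //=; rewrite (le_trans (ltW yu)).
  rewrite lebesgue_measure_itv/= lte_fin u0 oppr0 adde0.
  rewrite /Num.max /Num.min; congr EFin.
  by repeat case: ifPn; rewrite -?leNgt; lra.
rewrite (_ : _ `&` _ = `[0, 1]%classic); last first.
  apply/seteqP; split => y /=; rewrite !in_itv/=; first by case.
  by move=> /andP[-> y1]; split => //; rewrite (le_lt_trans y1).
rewrite lebesgue_measure_itv/= lte_fin ltr01 oppr0 adde0.
rewrite /Num.max /Num.min; congr EFin.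
by repeat case: ifPn; rewrite -?leNgt; lra.
Qed.

Lemma ray_measure_ext (R : realType) (m1 m2 : {measure set (measurableTypeR R) -> \bar R}) :
  (m1 setT < +oo)%E -> (forall u : R, m1 `]-oo, u[%classic = m2 `]-oo, u[%classic) ->
  forall A, measurable A -> m1 A = m2 A.
Proof.
move=> m1oo m12 A mA.
apply: (@measure_unique _ R (measurableTypeR R) (@RGenInftyO.G R)
  (fun n => `]-oo, n%:R[%classic)) => //.
- exact: RGenInftyO.measurableE.
- move=> _ _ [u ->] [v ->]; exists (Num.min u v).
  apply/seteqP; split => y /=; rewrite !in_itv/= lt_min; last by move/andP.
  by case=> -> ->.
- by move=> i; eexists.
- apply/seteqP; split => // y _; exists (Num.truncn y).+1 => //=.
  by rewrite in_itv/= truncnS_gt.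
- by move=> _ [u ->]; exact: m12.
- move=> k; apply: le_lt_trans m1oo; apply: le_measure => //; rewrite inE//.
Qed.

(** * Joint law of the first bits and of the complete coordinates *)

Section tail_law.
Context d (T : measurableType d) (R : realType) (P : probability T R).
Variable x : nat -> nat -> {RV P >-> bool}.
Hypothesis xP : iid_symmetric_bits x.
Implicit Types (s t : seq (nat * nat)) (b c : bit_array).

Definition binary_column (j : nat) (w : T) : R := binary R (bits x w ^~ j).

Lemma measurable_bits i j : measurable_fun setT (fun w => bits x w i j).
Proof. exact: measurable_funPT. Qed.

Lemma measurable_binary_column j : measurable_fun setT (binary_column j).
Proof. by apply: measurable_binary => i; exact: measurable_bits. Qed.

Lemma depends_on_dyadic (V : Type) j m (g : R -> V) t :
  depends_on (column j m ++ t) (fun c => g (dyadic R (c ^~ j) m)).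
Proof.
move=> b c bc; congr g; apply: eq_dyadic => i im.
by apply: (bc (i, j)); rewrite mem_cat mem_column im eqxx.
Qed.

Lemma squeeze_pow2 (a e q : R) :
  (forall m, `|a - e| <= q * 2^-1 ^+ m) -> a = e.
Proof.
move=> H; apply/eqP; rewrite -subr_eq0 -normr_le0.
have c0 : q * 2^-1 ^+ m @[m --> \oo] --> (0 : R).
  rewrite -[X in _ --> X](mulr0 q); apply: cvgMr.
  by apply: cvg_expr; rewrite ger0_norm; lra.
rewrite -(cvg_lim (@Rhausdorff R) c0).
apply: limr_ge; first by apply/cvg_ex; exists 0.
exact: nearW.
Qed.

(* On a ray, the binary expansion is squeezed between its truncations at level
   [m] and [m] plus [2 ^ - m], whose laws are found by counting. *)
Lemma prob_bits_column (adm : pred (nat * nat)) (E : set T) (q : R) j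
  (A : set R) : measurable E -> measurable A ->
  (forall t b, uniq t -> all adm t ->
    P (bit_cylinder x t b `&` E) = (2^-1 ^+ size t * q)%:E) ->
  (forall i, (1 <= i)%N -> adm (i, j)) ->
  forall t b, uniq t -> all (fun k => adm k && (k.2 != j)) t ->
  P (bit_cylinder x t b `&` (E `&` [set w | A (binary_column j w)])) =
  ((2^-1 ^+ size t * q)%:E * lebesgue_measure (A `&` `[0%R, 1%R]))%E.
Proof.
move=> mE + PE admj t b ut at_.
have mC := measurable_bit_cylinder x t b.
have adt : all adm t by apply: sub_all at_ => k /andP[].
have q0 : 0 <= 2^-1 ^+ size t * q by rewrite -lee_fin -(PE t b) ?measure_ge0.
pose F := bit_cylinder x t b `&` E.
have mF : measurable F by exact: measurableI.
pose m1 := pushforward (mrestr P mF) (binary_column j : T -> measurableTypeR R).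
have PX B : P (bit_cylinder x t b `&` (E `&` [set w | B (binary_column j w)])) =
    m1 B.
  by rewrite /m1 /pushforward /mrestr setIA [in RHS]setIC.
rewrite PX {PX}.
pose Q := NngNum q0.
have m01 : measurable (`[0, 1]%classic : set R) by [].
pose m2 := mscale Q (mrestr (@lebesgue_measure R) m01).
have mb := measurable_binary_column j.
have m1T : (m1 setT < +oo)%E.
  rewrite /m1 /pushforward /mrestr (le_lt_trans (probability_le1 _ _)) ?ltry//.
  by rewrite preimage_setT setTI.
rewrite -[RHS]/(m2 A) => mA.
have := (@ray_measure_ext R
  (pushforward (mrestr P mF) (binary_column j : T -> measurableTypeR R))
  (mscale Q (mrestr (@lebesgue_measure R) m01))).
move=> /(_ mb m1T); apply => // {A mA} u.
have mray : measurable (binary_column j @^-1` `]-oo, u[%classic).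
  by rewrite -[X in measurable X]setTI; exact: mb.
have m1fin : m1 `]-oo, u[%classic \is a fin_num.
  rewrite ge0_fin_numE ?measure_ge0//.
  by rewrite (le_lt_trans (probability_le1 _ _)) ?ltry//; apply: measurableI.
transitivity (Q%:num * Num.max 0 (Num.min u 1))%:E; last first.
  rewrite EFinM -lebesgue_unit_ray; exact: erefl.
rewrite -[LHS]/(m1 `]-oo, u[%classic) -(fineK m1fin); congr EFin.
apply: (@squeeze_pow2 _ _ Q%:num) => m.
have p0 : 0 < 2 ^+ m :> R by rewrite exprn_gt0.
have cu : uniq (column j m ++ t).
  rewrite cat_uniq uniq_column ut andbT; apply/hasPn => k kt.
  rewrite mem_column negb_and; apply/orP; right.
  by have /andP[] := allP at_ k kt.
have ca : all adm (column j m ++ t).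
  rewrite all_cat adt andbT; apply/allP => -[k1 k2].
  by rewrite mem_column => /andP[/andP[/= k1m _] /eqP ->]; exact: admj.
have cd (v : R) := @depends_on_dyadic _ j m (fun y : R => y < v) t.
have prob_event v := @prob_bit_event _ _ _ P x adm E q mE PE (column j m) t b
    (fun c => dyadic R (c ^~ j) m < v) cu ca (cd v).
have mED v : measurable (bit_cylinder x t b `&`
      (E `&` [set w | dyadic R (bits x w ^~ j) m < v])).
  by case: (prob_event v).
have PD (v : R) : P (bit_cylinder x t b `&`
      (E `&` [set w | dyadic R (bits x w ^~ j) m < v])) =
    (Q%:num * (2^-1 ^+ m * \sum_(0 <= k < 2 ^ m) (k%:R < v * 2 ^+ m)%R%:R))%:E.
  have [_ ->] := prob_event v.
  rewrite (bit_mean_column j m (fun y => (y < v)%R%:R)).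
  congr (_ * (_ * _))%:E; apply: eq_bigr => k _.
  by rewrite ltr_pdivrMr.
have p1 : 2^-1 ^+ m * 2 ^+ m = 1 :> R by rewrite -exprMn mulVf ?expr1n.
have half0 : 0 < 2^-1 ^+ m :> R by rewrite exprn_gt0// invr_gt0.
have clampE (y : R) : 2^-1 ^+ m * Num.max 0 (Num.min (y * 2 ^+ m) (2 ^ m)%:R) =
    Num.max 0 (Num.min y 1).
  by rewrite maxr_pMr ?minr_pMr ?ltW// mulr0 natrX mulrCA p1 mulr1.
have rayE : [set w | binary_column j w < u] = binary_column j @^-1` `]-oo, u[%classic.
  by apply/seteqP; split => w /=; rewrite in_itv.
have mE1 : measurable (bit_cylinder x t b `&`
    (E `&` [set w | binary_column j w < u])).
  by rewrite rayE; apply: measurableI => //; exact: measurableI.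
have m1E : m1 `]-oo, u[%classic = P (bit_cylinder x t b `&`
    (E `&` [set w | binary_column j w < u])).
  by rewrite rayE /m1 /pushforward /mrestr setIA setIC.
(* In the upper bound the truncation is free, since it lies below the expansion, and counting costs
   2^-m. In the lower bound [lo] counting is free and the truncation costs 2^-m. *)
have up : fine (m1 `]-oo, u[%classic) <=
    Q%:num * (Num.max 0 (Num.min u 1) + 2^-1 ^+ m).
  rewrite -lee_fin (fineK m1fin) m1E.
  apply: (@le_trans _ _ (P (bit_cylinder x t b `&`
      (E `&` [set w | dyadic R (bits x w ^~ j) m < u])))).
    apply: le_measure; rewrite ?inE//.
    move=> w [Cw [Ew /= uw]]; split => //; split => //=.
    exact: le_lt_trans (dyadic_le_binary _ _) uw.
  rewrite PD lee_fin ler_wpM2l//.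
  apply: (@le_trans _ _ (Num.max 0 (Num.min (u + 2^-1 ^+ m) 1))).
    have /andP[_] := count_lt_bounds (u * 2 ^+ m) (2 ^ m).
    rewrite -(clampE (u + _)) mulrDl p1 => h.
    by rewrite ler_pM2l.
  exact: clampD_le (ltW half0).
have lo : Q%:num * (Num.max 0 (Num.min u 1) - 2^-1 ^+ m) <=
    fine (m1 `]-oo, u[%classic).
  rewrite -lee_fin (fineK m1fin) m1E.
  apply: (@le_trans _ _ (P (bit_cylinder x t b `&`
      (E `&` [set w | dyadic R (bits x w ^~ j) m < u - 2^-1 ^+ m])))); last first.
    apply: le_measure; rewrite ?inE//.
    move=> w [Cw [Ew /= uw]]; split => //; split => //=.
    by rewrite (le_lt_trans (binary_le_dyadic _ m))// -ltrBrDr.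
  rewrite PD lee_fin ler_wpM2l//.
  apply: (@le_trans _ _ (Num.max 0 (Num.min (u - 2^-1 ^+ m) 1))).
    by rewrite lerBlDr -[u in leLHS](subrK (2^-1 ^+ m)) clampD_le// ltW.
  have /andP[+ _] := count_lt_bounds ((u - 2^-1 ^+ m) * 2 ^+ m) (2 ^ m).
  by rewrite -(clampE (u - _)) => h; rewrite ler_pM2l.
by rewrite ler_norml; apply/andP; split; lra.
Qed.

(** Columns are added one at a time: the constraint on a new column is joined to the event already
    treated, and the bits of that column cease to be admissible for the cylinder. *)
Lemma prob_tail_box o N t b (A : nat -> set R) :
  (forall j, measurable (A j)) -> uniq t ->
  all (fun k => (1 <= k.1) && ~~ (o <= k.2 < o + N))%N t ->
  P (bit_cylinder x t b `&`
     [set w | forall j, (j < N)%N -> A j (binary_column (o + j) w)]) =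
  ((2^-1 ^+ size t)%:E * \prod_(j < N) lebesgue_measure (A j `&` `[0%R, 1%R]))%E.
Proof.
move=> mA; elim: N t b => [|N IH] t b ut at_.
  rewrite (_ : [set w | _] = setT) ?setIT; last by apply/seteqP; split.
  rewrite big_ord0 mule1; apply: prob_bit_cylinder => //.
  by apply: sub_all at_ => k /andP[].
pose E := [set w | forall j, (j < N)%N -> A j (binary_column (o + j) w)].
rewrite (_ : [set w | _] = E `&` [set w | A N (binary_column (o + N) w)]); last first.
  apply/seteqP; split => w.
    by move=> H; split => [j jN|]; apply: H => //; exact: ltnW.
  by move=> [HE HN] j; rewrite ltnS leq_eqVlt => /predU1P[->//|]; exact: HE.
have mE : measurable E.
  have -> : E = \bigcap_j (if (j < N)%N then
      binary_column (o + j) @^-1` A j else setT).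
    apply/seteqP; split => w H j; first by move=> _; case: ifP => // /H.
    by move=> jN; have := H j I; rewrite jN.
  apply: bigcapT_measurable => j; case: ifP => // _.
  by rewrite -[X in measurable X]setTI; exact: measurable_binary_column.
pose q : \bar R := (\prod_(j < N) lebesgue_measure (A j `&` `[0%R, 1%R]))%E.
have qfin : q \is a fin_num.
  apply: (big_ind (fun z => z \is a fin_num)) => // [a b' ? ?|j _].
    exact: fin_numM.
  rewrite ge0_fin_numE ?measure_ge0//.
  apply: (@le_lt_trans _ _ (lebesgue_measure (`[0%R, 1%R]%classic : set R))).
    apply: le_measure => [||y []//]; rewrite inE; last exact: measurable_itv.
    by apply: measurableI; [exact: mA|exact: measurable_itv].
  by rewrite lebesgue_measure_itv/= lte_fin ltr01 sube0 ltry.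
have PE t' b' : uniq t' ->
    all (fun k => (1 <= k.1) && ~~ (o <= k.2 < o + N))%N t' ->
    P (bit_cylinder x t' b' `&` E) = (2^-1 ^+ size t' * fine q)%:E.
  by move=> ut' at'; rewrite IH// EFinM fineK.
rewrite (prob_bits_column mE (mA N) PE _ b ut).
- by rewrite EFinM fineK// -muleA big_ord_recr.
- by move=> i i1 /=; rewrite i1 ltnn andbF.
- apply: sub_all at_ => k /andP[-> H] /=; apply/andP; split; lia.
Qed.

(** With o = n + 1 this is the untruncated part of X^{m,n}, renumbered from 0; with o = 0 it is a
    random point of the cube with law [lam]. *)
Definition tail_column o w : cube R := fun j =>
  Itv01 (binary_ge0 R (bits x w ^~ (o + j)%N)) (binary_le1 R (bits x w ^~ (o + j)%N)).

Lemma measurable_tail_column o : measurable_fun setT (tail_column o).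
Proof. by apply: measurable_cubeP => j; exact: measurable_binary_column. Qed.

Variable lam : probability (cube R) R.
Hypothesis lamP : is_lebesgue_product lam.

(** Independence of the tail from the first [o] columns, together with its law: both sides are
    finite measures in [B] that agree on boxes. *)
Lemma prob_tail_column o t b B : uniq t ->
  all (fun k => (1 <= k.1) && (k.2 < o))%N t -> measurable B ->
  P (bit_cylinder x t b `&` tail_column o @^-1` B) = ((2^-1 ^+ size t)%:E * lam B)%E.
Proof.
move=> ut at_ mB.
have mC := measurable_bit_cylinder x t b.
have h0 : 0 <= 2^-1 ^+ size t :> R by rewrite exprn_ge0// invr_ge0.
pose m1 := pushforward (mrestr P mC) (tail_column o).
pose m2 := mscale (NngNum h0) lam.
have m1T : (m1 setT < +oo)%E.
  rewrite /m1 /pushforward /mrestr (le_lt_trans (probability_le1 _ _)) ?ltry//.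
  by rewrite preimage_setT setTI.
transitivity (m1 B); first by rewrite /m1 /pushforward /mrestr setIC.
transitivity (m2 B); last by [].
have := (@cube_measure_ext R 0 (pushforward (mrestr P mC) (tail_column o))
  (mscale (NngNum h0) lam)).
move=> /(_ (measurable_tail_column o) m1T); apply => // n A _ mA.
rewrite -[RHS]/((2^-1 ^+ size t)%:E * lam (cube_box n A))%E (lam_box lamP _ mA).
rewrite -(@prob_tail_box o n.+1 t b A mA ut).
  rewrite /pushforward /mrestr setIC.
  by congr (P (_ `&` _)).
by apply: sub_all at_ => k /andP[-> H]; rewrite (leqNgt o) H.
Qed.

Lemma ge0_integral_mrestr (E : set T) (mE : measurable E) (f : T -> \bar R) :
  measurable_fun setT f -> (forall w, 0 <= f w)%E ->
  (\int[mrestr P mE]_w f w = \int[P]_(w in E) f w)%E.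
Proof.
move=> mf f0; rewrite -(setUv E) ge0_integral_setU//=; last 3 first.
- exact: measurableC.
- by rewrite setUv.
- by rewrite disj_set2E setICr.
rewrite [X in (_ + X)%E](_ : _ = 0%E) ?adde0.
  apply: eq_measure_integral => A mA AE.
  by rewrite -[LHS]/(P (_ `&` _)) setIidl.
rewrite (eq_measure_integral mzero); first exact: integral_measure_zero.
move=> A mA AE; rewrite -[LHS]/(P (_ `&` _)) /mzero.
rewrite (_ : A `&` E = set0) ?measure0//.
by apply/seteqP; split => // w [/AE].
Qed.

(** A one-sided Fubini theorem for bits and tail. The lower bound [r] on the inner integral leaves
    room for Jensen's inequality; the bits of [s] move into the cylinder until [h] no longer varies
    with them. *)
Lemma le_integral_tail_column o s t b (h : bit_array -> cube R -> \bar R)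
    (r : bit_array -> R) :
  uniq (s ++ t) -> all (fun k => (1 <= k.1) && (k.2 < o))%N (s ++ t) ->
  (forall c, measurable_fun setT (h c)) -> (forall c z, 0 <= h c z)%E ->
  measurable_fun setT (fun w => h (bits x w) (tail_column o w)) ->
  depends_on (s ++ t) h ->
  (forall c, (r c)%:E <= \int[lam]_z h c z)%E ->
  ((2^-1 ^+ size t * bit_mean s r b)%:E <=
   \int[P]_(w in bit_cylinder x t b) h (bits x w) (tail_column o w))%E.
Proof.
move=> + + mh h0 mhx + rh.
elim: s t b => [|k s IH] t b /=.
  move=> ut at_ ht.
  have mC := measurable_bit_cylinder x t b.
  have n0 : 0 <= 2^-1 ^+ size t :> R by rewrite exprn_ge0// invr_ge0.
  rewrite (_ : (\int[P]_(w in _) _)%E = ((2^-1 ^+ size t)%:E * \int[lam]_z h b z)%E).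
    by rewrite EFinM lee_pmul2l// lte_fin exprn_gt0// invr_gt0.
  transitivity (\int[mscale (NngNum n0) lam]_z h b z)%E; last first.
    by rewrite ge0_integral_mscale.
  pose m1 := pushforward (mrestr P mC) (tail_column o).
  transitivity (\int[m1]_z h b z)%E; last first.
    apply: eq_measure_integral; first exact: measurable_tail_column.
    move=> mt A mA _; transitivity (P (bit_cylinder x t b `&` tail_column o @^-1` A)).
      by rewrite /= /pushforward /mrestr setIC.
    by rewrite prob_tail_column.
  rewrite /m1 ge0_integral_pushforward//=; last exact: measurable_tail_column.
  rewrite preimage_setT ge0_integral_mrestr//; last first.
    exact: measurableT_comp (mh b) (measurable_tail_column o).
  apply: eq_integral => w; rewrite inE => wC.
  by rewrite (bit_cylinder_depends ht wC).
move=> /andP[kst ust] /andP[ak ast] hst.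
have kt : k \notin t by move: kst; rewrite mem_cat negb_or => /andP[].
have skt : perm_eq (s ++ k :: t) (k :: s ++ t) := permEl (perm_catCA s [:: k] t).
have u' : uniq (s ++ k :: t) by rewrite (perm_uniq skt) /= kst.
have a' : all (fun k => (1 <= k.1) && (k.2 < o))%N (s ++ k :: t).
  by rewrite (perm_all _ skt) /= ak.
have d' : depends_on (s ++ k :: t) h.
  by move=> c c' cc'; apply: hst => l ls; apply: cc'; rewrite (perm_mem skt).
have H1 := IH (k :: t) (flip b k true) u' a' d'.
have H0 := IH (k :: t) (flip b k false) u' a' d'.
have := bit_cylinder_split x b setT kt; rewrite !setIT => ->.
rewrite ge0_integral_setU//; last 4 first.
- exact: measurable_bit_cylinder.
- exact: measurable_bit_cylinder.
- exact: measurable_funTS.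
- by have := bit_cylinder_disj x k t b setT; rewrite !setIT.
apply: le_trans (leeD H1 H0); rewrite -EFinD lee_fin.
rewrite -[bit_mean s (bit_avg k _) b]/(bit_mean (k :: s) _ b).
by rewrite bit_mean_cons /= exprS; lra.
Qed.

End tail_law.

(** * Density of the functions of finitely many coordinates *)

Section cylinder_density.
Import HBNNSimple.
Context {R : realType}.
Variable lam : probability (cube R) R.
Implicit Types (f g h k : cube R -> R).

Definition head_dependent (d : nat) (V : Type) (k : cube R -> V) :=
  forall y y' : cube R, (forall j, (j < d)%N -> y j = y' j) -> k y = k y'.

Definition sqr_dist f g : \bar R := (\int[lam]_y ((f y - g y) ^+ 2)%:E)%E.

Definition cylinder_approximable f := forall eps : R, 0 < eps ->
  exists d k, [/\ measurable_fun setT k, head_dependent d k &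
    (sqr_dist f k <= eps%:E)%E].

(** The factor 2, from (a + b)^2 <= 2 (a^2 + b^2), is the source of the tolerances e / 4 below. *)
Lemma sqr_dist_triangle f g h :
  measurable_fun setT f -> measurable_fun setT g -> measurable_fun setT h ->
  (sqr_dist f h <= 2%:E * (sqr_dist f g + sqr_dist g h))%E.
Proof.
move=> mf mg mh.
have m2 (u v : cube R -> R) : measurable_fun setT u -> measurable_fun setT v ->
    measurable_fun setT (fun y => ((u y - v y) ^+ 2)%:E).
  by move=> mu mv; apply/measurable_EFinP; apply: measurable_funX; exact: measurable_funB.
have p2 (u v : cube R -> R) y : (0 <= ((u y - v y) ^+ 2)%:E)%E.
  by rewrite lee_fin sqr_ge0.
rewrite /sqr_dist -ge0_integralD//; [|exact: m2|exact: m2].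
rewrite -ge0_integralZl//; last 2 first.
- by apply: emeasurable_funD; exact: m2.
- by move=> y _; rewrite -EFinD lee_fin addr_ge0// sqr_ge0.
apply: ge0_le_integral => //.
- exact: m2.
- by apply: measurable_funeM; apply: emeasurable_funD; exact: m2.
- move=> y _; rewrite -EFinD -EFinM lee_fin.
  by have := sqr_ge0 ((f y - g y) - (g y - h y)); rewrite !expr2; lra.
Qed.

Lemma head_dependent_le d d' (V : Type) (k : cube R -> V) : (d <= d')%N ->
  head_dependent d k -> head_dependent d' k.
Proof. by move=> dd' kd y y' yy'; apply: kd => j jd; apply: yy'; exact: leq_trans dd'. Qed.

Lemma cylinder_approximableB f g :
  measurable_fun setT f -> measurable_fun setT g ->
  cylinder_approximable f -> cylinder_approximable g ->
  cylinder_approximable (fun y => f y - g y).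
Proof.
move=> mf mg af ag e e0.
have e4 : 0 < e / 4 by lra.
have [d1 [k1 [m1 h1 s1]]] := af _ e4; have [d2 [k2 [m2 h2 s2]]] := ag _ e4.
exists (maxn d1 d2), (fun y => k1 y - k2 y); split.
- exact: measurable_funB.
- move=> y y' yy'; rewrite (head_dependent_le (leq_maxl _ d2) h1 yy').
  by rewrite (head_dependent_le (leq_maxr d1 _) h2 yy').
have := @sqr_dist_triangle (fun y => f y - g y) (fun y => k1 y - g y)
  (fun y => k1 y - k2 y).
move=> /(_ (measurable_funB mf mg) (measurable_funB m1 mg) (measurable_funB m1 m2)).
have -> : sqr_dist (fun y => f y - g y) (fun y => k1 y - g y) = sqr_dist f k1.
  by apply: eq_integral => y _; congr (_ ^+ 2)%:E; lra.
have -> : sqr_dist (fun y => k1 y - g y) (fun y => k1 y - k2 y) = sqr_dist g k2.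
  by apply: eq_integral => y _; congr EFin; rewrite -sqrrN; congr (_ ^+ 2); lra.
move=> /le_trans; apply.
apply: (@le_trans _ _ (2%:E * ((e / 4)%:E + (e / 4)%:E))%E).
  by rewrite lee_pmul2l// leeD.
by rewrite -EFinD -EFinM lee_fin; lra.
Qed.

Lemma cylinder_approximable_lim f : measurable_fun setT f ->
  (forall eps : R, 0 < eps -> exists g, [/\ measurable_fun setT g,
     cylinder_approximable g & (sqr_dist f g <= eps%:E)%E]) ->
  cylinder_approximable f.
Proof.
move=> mf H e e0; have e4 : 0 < e / 4 by lra.
have [g [mg ag sg]] := H _ e4; have [d [k [mk hk sk]]] := ag _ e4.
exists d, k; split => //.
apply: (le_trans (sqr_dist_triangle mf mg mk)).
apply: (@le_trans _ _ (2%:E * ((e / 4)%:E + (e / 4)%:E))%E).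
  by rewrite lee_pmul2l// leeD.
by rewrite -EFinD -EFinM lee_fin; lra.
Qed.

Lemma sqr_distZ c f g : measurable_fun setT f -> measurable_fun setT g ->
  sqr_dist (fun y => c * f y) (fun y => c * g y) = ((c ^+ 2)%:E * sqr_dist f g)%E.
Proof.
move=> mf mg; rewrite /sqr_dist -ge0_integralZl//.
- by apply: eq_integral => y _; rewrite -EFinM -exprMn mulrBr.
- by apply/measurable_EFinP; apply: measurable_funX; exact: measurable_funB.
- by move=> y _; rewrite lee_fin sqr_ge0.
- by rewrite lee_fin sqr_ge0.
Qed.

Lemma sqr_distxx f : sqr_dist f f = 0%E.
Proof.
by rewrite /sqr_dist; apply: integral0_eq => y _; rewrite subrr expr0n.
Qed.

Lemma cylinder_approximableZ c f : measurable_fun setT f ->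
  cylinder_approximable f -> cylinder_approximable (fun y => c * f y).
Proof.
move=> mf af e e0.
(* Adding 1 allows the division even when c = 0. *)
have c0 : 0 < c ^+ 2 + 1 by rewrite ltr_wpDl ?sqr_ge0.
have [d [k [mk hk sk]]] := af _ (divr_gt0 e0 c0).
exists d, (fun y => c * k y); split.
- exact: measurable_funM.
- by move=> y y' yy'; rewrite (hk _ _ yy').
rewrite sqr_distZ//; apply: (@le_trans _ _ ((c ^+ 2)%:E * (e / (c ^+ 2 + 1))%:E)%E).
  by rewrite lee_wpmul2l// lee_fin sqr_ge0.
rewrite -EFinM lee_fin mulrCA ger_pMr// ler_pdivrMr// mul1r; lra.
Qed.

Lemma cylinder_approximable_cyl d f : measurable_fun setT f ->
  head_dependent d f -> cylinder_approximable f.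
Proof.
move=> mf hf e e0; exists d, f; split => //.
by rewrite sqr_distxx lee_fin ltW.
Qed.

Lemma cylinder_approximable_sum (I : Type) (r : seq I) (F : I -> cube R -> R) :
  (forall i, measurable_fun setT (F i)) ->
  (forall i, cylinder_approximable (F i)) ->
  cylinder_approximable (fun y => \sum_(i <- r) F i y).
Proof.
move=> mF aF; elim: r => [|i r IH].
  apply: (@cylinder_approximable_cyl 0); first exact: measurable_sum.
  by move=> y y' _; rewrite !big_nil.
have -> : (fun y => \sum_(j <- i :: r) F j y) =
    (fun y => F i y - (-1) * \sum_(j <- r) F j y).
  by apply/funext => y; rewrite big_cons mulN1r opprK.
have ms : measurable_fun setT (fun y => \sum_(j <- r) F j y).
  exact: measurable_sum.
apply: cylinder_approximableB => //; first exact: measurable_funM.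
exact: cylinder_approximableZ.
Qed.

Lemma cvge0_exists (u : nat -> \bar R) : u @ \oo --> 0%E ->
  forall eps : R, 0 < eps -> exists n, (u n <= eps%:E)%E.
Proof.
move=> /fine_cvgP[ufin u0] e e0.
have /cvgrPdist_le/(_ e e0) := u0.
case: ufin => N1 _ H1 [N2 _ H2]; exists (maxn N1 N2).
have := H2 (maxn N1 N2) (leq_maxr _ _); rewrite /= sub0r normrN => h.
rewrite -(fineK (H1 (maxn N1 N2) (leq_maxl _ _))) lee_fin.
exact: le_trans (ler_norm _) h.
Qed.

(** The sets with approximable indicator form a lambda-system that contains the pi-system of boxes;
    increasing unions are handled by continuity of the measure. *)
Lemma cylinder_approximable_indic (A : set (cube R)) : measurable A ->
  cylinder_approximable (\1_A).
Proof.
move: A; rewrite (measurable_cube_boxesE 0).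
pose H : set (set (cube R)) :=
  [set A | measurable A /\ cylinder_approximable (\1_A)].
suff HA : <<s cube_boxes 0 >> `<=` H by move=> A /HA[].
apply: (lambda_system_subset (@setI_cube_boxes R 0)) => //; last first.
  move=> _ [n [A [_ mA] ->]]; split; first exact: measurable_cube_box.
  apply: (@cylinder_approximable_cyl n.+1).
    by apply: measurable_indic; exact: measurable_cube_box.
  move=> y y' yy'; rewrite !indicE; congr (nat_of_bool _)%:R.
  apply/idP/idP; rewrite !inE => yA j jn.
    by rewrite -yy'//; exact: yA.
  by rewrite yy'//; exact: yA.
split => //.
- split=> //; rewrite indicT; exact: (@cylinder_approximable_cyl 0).
- move=> A B BA [mA aA] [mB aB]; split; first exact: measurableD.
  have -> : \1_(A `\` B) = (fun y => \1_A y - \1_B y) :> (cube R -> R).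
    apply/funext => y; rewrite !indicE in_setD.
    have [yB|yB] := boolP (y \in B); last by rewrite andbT subr0.
    by rewrite andbF mem_set ?subrr//; apply: BA; rewrite -inE.
  by apply: cylinder_approximableB => //; exact: measurable_indic.
- move=> F ndF HF.
  have mF i : measurable (F i) by case: (HF i).
  have mU : measurable (\bigcup_i F i) by exact: bigcupT_measurable.
  split => //; apply: cylinder_approximable_lim; first exact: measurable_indic.
  move=> e e0.
  have sE i : sqr_dist (\1_(\bigcup_i F i)) (\1_(F i)) =
      lam (\bigcup_i F i `\` F i).
    have FU : F i `<=` \bigcup_i F i by exact: bigcup_sup.
    rewrite -[in RHS](setIT (_ `\` _)) -integral_indic//; last exact: measurableD.
    apply: eq_integral => y _; congr EFin; rewrite !indicE in_setD.
    have [yF|yF] := boolP (y \in F i).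
      by rewrite andbF mem_set ?subrr ?expr0n//; apply: FU; rewrite -inE.
    by rewrite andbT subr0; case: (_ \in _); rewrite ?expr1n ?expr0n.
  have cvg0 : (fun i => lam (\bigcup_i F i `\` F i)) @ \oo --> 0%E.
    rewrite -(measure0 lam).
    rewrite (_ : set0 = \bigcap_i (\bigcup_i F i `\` F i)); last first.
      apply/seteqP; split => // y Hy; have [[j _ yj] _] := Hy 0%N I.
      by have [_] := Hy j I.
    apply: nonincreasing_cvg_mu.
    - by rewrite (le_lt_trans (probability_le1 _ _)) ?ltry//; exact: measurableD.
    - by move=> i; exact: measurableD.
    - by apply: bigcapT_measurable => i; exact: measurableD.
    - move=> i j ij; apply/subsetPset => y [yU yF]; split => // yi; apply: yF.
      by move: yi; have /subsetPset := ndF _ _ ij; exact.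
  have [i ie] := cvge0_exists cvg0 e0.
  exists (\1_(F i)); rewrite sE; split => //.
  by case: (HF i).
Qed.

(** Simple functions increase to [f], and the squared errors are dominated by f^2. *)
Lemma cylinder_approximable_nneg f : measurable_fun setT f ->
  lam.-integrable setT (fun y => (f y ^+ 2)%:E) -> (forall y, 0 <= f y) ->
  cylinder_approximable f.
Proof.
move=> mf f2 f0; apply: cylinder_approximable_lim => // e e0.
have mEf : measurable_fun setT (EFin \o f) by exact/measurable_EFinP.
pose g := nnsfun_approx measurableT mEf.
have gf y : g n y @[n --> \oo] --> f y.
  have := @cvg_nnsfun_approx _ _ _ _ measurableT _ mEf.
  have f0' : forall z, setT z -> (0 <= (EFin \o f) z)%E.
    by move=> z _; rewrite lee_fin.
  by move=> /(_ f0' y I) /fine_cvgP[_].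
have g_le n y : g n y <= f y.
  rewrite -(cvg_lim (@Rhausdorff R) (gf y)).
  apply: (@nondecreasing_cvgn_le _ (fun n => g n y)).
    by move=> i j ij; have /lefP := nd_nnsfun_approx measurableT mEf ij; exact.
  by apply/cvg_ex; exists (f y).
have cvg0 : (fun n => sqr_dist f (g n)) @ \oo --> 0%E.
  have [||||_ _] := @dominated_convergence _ _ _ lam setT measurableT
    (fun n y => ((f y - g n y) ^+ 2)%:E) (cst 0%E) (fun y => (f y ^+ 2)%:E) _ _ _ f2.
  - move=> n; apply/measurable_EFinP; apply: measurable_funX.
    by apply: measurable_funB => //.
  - exact: measurable_cst.
  - apply: aeW => y _; apply/fine_cvgP; split; first exact: nearW.
    have c1 : f y - g n y @[n --> \oo] --> 0.
      by rewrite -(subrr (f y)); apply: cvgB => //; exact: cvg_cst.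
    by have := cvgM c1 c1; rewrite mulr0; apply.
  - apply: aeW => y n _; rewrite lee_fin ger0_norm ?sqr_ge0//.
    rewrite ler_pXn2r ?nnegrE ?subr_ge0//.
    by rewrite gerBl; exact: fun_ge0.
  by rewrite integral0.
have [n ne] := cvge0_exists cvg0 e0.
exists (g n); split => //.
rewrite (funext (fimfunEord (g n))); apply: cylinder_approximable_sum => i.
  by apply: measurable_funM => //; exact: measurable_indic.
apply: cylinder_approximableZ; first exact: measurable_indic.
exact: cylinder_approximable_indic.
Qed.

Lemma cylinder_approximable_sqr_integrable f : measurable_fun setT f ->
  lam.-integrable setT (fun y => (f y ^+ 2)%:E) -> cylinder_approximable f.
Proof.
move=> mf f2.
have -> : f = (fun y => (f^\+ y - f^\- y)%R).
  by rewrite -[LHS]funrposBneg.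
have mp := measurable_funrpos mf; have mn := measurable_funrneg mf.
have sub (h : cube R -> R) : measurable_fun setT h ->
    (forall y, 0 <= h y <= `|f y|) -> lam.-integrable setT (fun y => (h y ^+ 2)%:E).
  move=> mh hf; apply: le_integrable f2 => //.
    by apply/measurable_EFinP; exact: measurable_funX.
  move=> y _; have /andP[h0 hy] := hf y.
  by rewrite lee_fin !ger0_norm ?sqr_ge0// -[f y ^+ 2]real_normK ?num_real// ler_pXn2r ?nnegrE.
apply: cylinder_approximableB => //; apply: cylinder_approximable_nneg => //.
- apply: sub => // y; rewrite funrpos_ge0/=.
  by rewrite /funrpos /Num.max; case: ifP; rewrite ?normr_ge0// ler_norm.
- apply: sub => // y; rewrite funrneg_ge0/=.
  rewrite /funrneg /Num.max; case: ifP; rewrite ?normr_ge0// => _.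
  by rewrite -normrN ler_norm.
Qed.

End cylinder_density.

(** * Jensen's inequality and minimality of the variance *)

Section second_moments.
Context d (T : measurableType d) (R : realType) (P : probability T R).
Variable phi : T -> R.
Hypothesis iphi : P.-integrable setT (EFin \o phi).

Let mphi : measurable_fun setT phi.
Proof. by apply/measurable_EFinP; exact: measurable_int iphi. Qed.

Let msqr c : measurable_fun setT (fun z => ((phi z - c) ^+ 2)%:E).
Proof. by apply/measurable_EFinP; apply: measurable_funX; exact: measurable_funB. Qed.

Lemma integrable_affine (a c : R) : P.-integrable setT (fun z => (a * phi z + c)%:E).
Proof.
have -> : (fun z => (a * phi z + c)%:E) =
  (fun z => (a%:E * (EFin \o phi) z + (cst c z)%:E)%E).
  by apply/funext => z; rewrite -EFinM -EFinD.
apply: integrableD => //; first exact: integrableZl.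
exact: finite_measure_integrable_cst.
Qed.

Lemma integral_affine (a c : R) :
  (\int[P]_z (a * phi z + c)%:E)%E = (a * \int[P]_z phi z + c)%:E.
Proof.
have fin : (\int[P]_z (phi z)%:E)%E \is a fin_num by exact: integrable_fin_num.
under eq_integral do rewrite EFinD EFinM.
rewrite integralD//=; last 2 first.
- exact: integrableZl.
- exact: finite_measure_integrable_cst.
have -> : (\int[P]_z c%:E)%E = c%:E.
  rewrite (integral_cst P measurableT) -[RHS]mule1.
  by congr (_ * _)%E; exact: probability_setT.
by rewrite integralZl// EFinD EFinM /Rintegral fineK.
Qed.

Lemma sqr_Rintegral_le :
  (((\int[P]_z phi z) ^+ 2)%:E <= \int[P]_z (phi z ^+ 2)%:E)%E.
Proof.
set A := \int[P]_z phi z.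
have -> : (A ^+ 2)%:E = (\int[P]_z (2 * A * phi z + - A ^+ 2)%:E)%E.
  by rewrite integral_affine -/A; congr EFin; ring.
have [->|] := eqVneq (\int[P]_z (phi z ^+ 2)%:E)%E +oo%E; first by rewrite leey.
move=> fin; apply: le_integral => //.
- exact: integrable_affine.
- apply/integrableP; split.
    by apply/measurable_EFinP; exact: measurable_funX.
  under eq_integral do rewrite gee0_abs ?lee_fin ?sqr_ge0//.
  by rewrite ltey.
- by move=> z _; rewrite lee_fin; have := sqr_ge0 (phi z - A); rewrite !expr2; lra.
Qed.

(** The mean is the constant closest to [phi] in L^2, so the variance is at most the mean squared
    distance to [c]. *)
Lemma integral_sqr_le c :
  (\int[P]_z (phi z ^+ 2)%:E <=
   ((\int[P]_z phi z) ^+ 2)%:E + \int[P]_z ((phi z - c) ^+ 2)%:E)%E.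
Proof.
set A := \int[P]_z phi z.
have p0 : (0 <= \int[P]_z ((phi z - c) ^+ 2)%:E)%E.
  by apply: integral_ge0 => z _; rewrite lee_fin sqr_ge0.
have [->|fin] := eqVneq (\int[P]_z ((phi z - c) ^+ 2)%:E)%E +oo%E.
  by rewrite addey// leey.
have isq : P.-integrable setT (fun z => ((phi z - c) ^+ 2)%:E).
  apply/integrableP; split; first exact: msqr.
  under eq_integral do rewrite gee0_abs ?lee_fin ?sqr_ge0//.
  by rewrite ltey.
have -> : (\int[P]_z (phi z ^+ 2)%:E)%E =
    (\int[P]_z (((phi z - c) ^+ 2)%:E + (2 * c * phi z + - c ^+ 2)%:E))%E.
  by apply: eq_integral => z _; rewrite -EFinD; congr EFin; ring.
rewrite integralD//; last exact: integrable_affine.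
rewrite integral_affine -/A addeC leeD2r// lee_fin.
by have := sqr_ge0 (A - c); rewrite !expr2; lra.
Qed.

End second_moments.

(** * Moments of the averages over the tail *)

Section tail_moments.
Context {R : realType}.
Variable lam : probability (cube R) R.
Hypothesis lamP : is_lebesgue_product lam.
Variable f : cube R -> R.
Hypothesis mf : measurable_fun setT f.
Hypothesis if2 : lam.-integrable setT (fun y => (f y ^+ 2)%:E).
Variable d : nat.
Hypothesis ifs : forall y : cube R,
  lam.-integrable setT (fun z => (f (splice (@cube_head R d y) z))%:E).

Definition tail_mean (y : cube R) : R := \int[lam]_z f (splice (@cube_head R d y) z).

(** [splice_tonelli] concerns nonnegative functions, so measurability and the mean of [tail_mean]
    are obtained from the positive and negative parts, whose tail integrals are finite for every
    [y]. *)
Let pos_mean (y : cube R) : \bar R :=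
  (\int[lam]_z (f^\+ (splice (@cube_head R d y) z))%:E)%E.
Let neg_mean (y : cube R) : \bar R :=
  (\int[lam]_z (f^\- (splice (@cube_head R d y) z))%:E)%E.

Let ipos y : lam.-integrable setT (fun z => (f^\+ (splice (@cube_head R d y) z))%:E).
Proof. exact: (integrable_funrpos measurableT (ifs y)). Qed.

Let ineg y : lam.-integrable setT (fun z => (f^\- (splice (@cube_head R d y) z))%:E).
Proof. exact: (integrable_funrneg measurableT (ifs y)). Qed.

Let pos_fin y : pos_mean y \is a fin_num.
Proof. exact: integrable_fin_num. Qed.

Let neg_fin y : neg_mean y \is a fin_num.
Proof. exact: integrable_fin_num. Qed.

Let tail_meanE y : (tail_mean y)%:E = (pos_mean y - neg_mean y)%E.
Proof.
rewrite /tail_mean /Rintegral fineK; last exact: integrable_fin_num.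
rewrite /pos_mean /neg_mean -integralB//.
by apply: eq_integral => z _; rewrite -EFinB -[in LHS](funrposBneg f).
Qed.

Let mpos : measurable_fun setT pos_mean.
Proof.
apply: (@measurable_splice_tonelli R lam d (fun y => (f^\+ y)%:E)).
  by apply/measurable_EFinP; exact: measurable_funrpos.
by move=> y; rewrite lee_fin funrpos_ge0.
Qed.

Let mneg : measurable_fun setT neg_mean.
Proof.
apply: (@measurable_splice_tonelli R lam d (fun y => (f^\- y)%:E)).
  by apply/measurable_EFinP; exact: measurable_funrneg.
by move=> y; rewrite lee_fin funrneg_ge0.
Qed.

Lemma measurable_tail_mean : measurable_fun setT tail_mean.
Proof.
apply/measurable_EFinP; apply: (eq_measurable_fun (fun y => pos_mean y - neg_mean y)%E).
  by move=> y _; rewrite /= tail_meanE.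
exact: emeasurable_funB.
Qed.

Let if1 : lam.-integrable setT (EFin \o f).
Proof.
apply: (@le_integrable _ _ _ lam setT measurableT _
    (fun y => (cst 1 y + f y ^+ 2)%:E)) => //.
- exact/measurable_EFinP.
- move=> y _; rewrite lee_fin [X in _ <= X]ger0_norm ?addr_ge0 ?sqr_ge0//.
  rewrite -[f y ^+ 2]real_normK ?num_real//=.
  by have := sqr_ge0 (`|f y| - 1); rewrite !expr2; have := normr_ge0 (f y); nra.
- have -> : (fun y => (cst 1 y + f y ^+ 2)%:E) = (fun y => ((cst 1 y)%:E + (f y ^+ 2)%:E)%E).
    by [].
  by apply: integrableD => //; exact: finite_measure_integrable_cst.
Qed.

Lemma integral_tail_mean : (\int[lam]_y (tail_mean y)%:E = \int[lam]_y (f y)%:E)%E.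
Proof.
have posE : (\int[lam]_y pos_mean y = \int[lam]_y (f^\+ y)%:E)%E.
  rewrite -(@splice_tonelli R lam lamP d (fun y => (f^\+ y)%:E))//.
    by apply/measurable_EFinP; exact: measurable_funrpos.
  by move=> y; rewrite lee_fin funrpos_ge0.
have negE : (\int[lam]_y neg_mean y = \int[lam]_y (f^\- y)%:E)%E.
  rewrite -(@splice_tonelli R lam lamP d (fun y => (f^\- y)%:E))//.
    by apply/measurable_EFinP; exact: measurable_funrneg.
  by move=> y; rewrite lee_fin funrneg_ge0.
have ip := integrable_funrpos measurableT if1.
have ineg' := integrable_funrneg measurableT if1.
have pos0 y : (0 <= pos_mean y)%E.
  by apply: integral_ge0 => z _; rewrite lee_fin funrpos_ge0.
have neg0 y : (0 <= neg_mean y)%E.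
  by apply: integral_ge0 => z _; rewrite lee_fin funrneg_ge0.
under eq_integral do rewrite tail_meanE.
rewrite integralB//; last 2 first.
- apply/integrableP; split => //.
  under eq_integral do rewrite gee0_abs//.
  by rewrite posE ltey_eq integrable_fin_num.
- apply/integrableP; split => //.
  under eq_integral do rewrite gee0_abs//.
  by rewrite negE ltey_eq integrable_fin_num.
rewrite posE negE -integralB//.
by apply: eq_integral => y _; rewrite -EFinB -[in RHS](funrposBneg f).
Qed.

Let msq (g : cube R -> R) : measurable_fun setT g ->
  measurable_fun setT (fun y => (g y ^+ 2)%:E).
Proof. by move=> mg; apply/measurable_EFinP; exact: measurable_funX. Qed.

Lemma integral_sqr_tail_mean_le :
  (\int[lam]_y (tail_mean y ^+ 2)%:E <= \int[lam]_y (f y ^+ 2)%:E)%E.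
Proof.
have sq0 (g : cube R -> R) y : (0 <= (g y ^+ 2)%:E)%E by rewrite lee_fin sqr_ge0.
rewrite (@splice_tonelli R lam lamP d (fun y => (f y ^+ 2)%:E) (msq mf) (sq0 f)).
apply: ge0_le_integral => //.
- by apply: msq; exact: measurable_tail_mean.
- apply: (@measurable_splice_tonelli R lam d (fun y => (f y ^+ 2)%:E)) => //.
  exact: msq.
- by move=> y _; exact: (sqr_Rintegral_le (ifs y)).
Qed.

(** On the fibre over a fixed head, [k] is the constant [k y], so [integral_sqr_le] applies there.
    Hence averaging over the tail loses no more second moment than the squared distance from [f] to
    any function of the first d coordinates. *)
Lemma integral_sqr_tail_mean_ge k : measurable_fun setT k -> head_dependent d k ->
  (\int[lam]_y (f y ^+ 2)%:E <=
   \int[lam]_y (tail_mean y ^+ 2)%:E + sqr_dist lam f k)%E.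
Proof.
move=> mk hk.
have sq0 (g : cube R -> R) y : (0 <= (g y ^+ 2)%:E)%E by rewrite lee_fin sqr_ge0.
have mfk : measurable_fun setT (fun y => f y - k y) by exact: measurable_funB.
rewrite /sqr_dist (@splice_tonelli R lam lamP d (fun y => (f y ^+ 2)%:E) (msq mf) (sq0 f)).
rewrite (@splice_tonelli R lam lamP d (fun y => ((f y - k y) ^+ 2)%:E)); last 2 first.
- exact: (msq mfk).
- by move=> y; exact: (sq0 (fun y => f y - k y)).
have mt1 := @measurable_splice_tonelli R lam d (fun y => (f y ^+ 2)%:E) (msq mf) (sq0 f).
have mt2 := @measurable_splice_tonelli R lam d (fun y => ((f y - k y) ^+ 2)%:E)
  (msq mfk) (sq0 (fun y => f y - k y)).
rewrite -ge0_integralD//; last 2 first.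
- by apply: msq; exact: measurable_tail_mean.
- by move=> y _; apply: integral_ge0 => z _; exact: (sq0 (fun y => f y - k y)).
apply: ge0_le_integral => //.
- by move=> y _; apply: integral_ge0 => z _; exact: sq0.
- by apply: emeasurable_funD => //; apply: msq; exact: measurable_tail_mean.
- move=> y _; have := integral_sqr_le (ifs y) (k y).
  congr (_ <= _ + _)%E; apply: eq_integral => z _.
  congr ((_ - _) ^+ 2)%:E; apply: hk => j jd.
  by rewrite splice_lt.
Qed.

End tail_moments.

(** * Riemann sums on dyadic grids *)

Section riemann_dyadic.
Context {R : realType} (d : nat).
Implicit Types (g : ('I_d -> {i01 R}) -> R) (m : nat).

Definition dyadic_grid m (k : 'I_d) (i : nat) : R := i%:R / 2 ^+ m.

Definition dyadic_tagging m (t : {ffun 'I_d -> 'I_(2 ^ m)} -> 'I_d -> {i01 R}) :=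
  is_tagging (dyadic_grid m) t.

Let pow_gt0 m : 0 < 2 ^+ m :> R. Proof. by rewrite exprn_gt0. Qed.

Lemma is_grid_dyadic m : is_grid (2 ^ m) (dyadic_grid m).
Proof.
move=> k; rewrite /dyadic_grid; split.
- by rewrite mul0r.
- by rewrite natrX divff// gt_eqF.
- by move=> i _; rewrite ler_pM2r ?invr_gt0// ler_nat.
Qed.

Lemma dyadic_grid_step m k i :
  dyadic_grid m k i.+1 - dyadic_grid m k i = 2^-1 ^+ m :> R.
Proof. by rewrite /dyadic_grid -natr1 -mulrBl addrAC subrr add0r mul1r exprVn. Qed.

Lemma riemann_sum_dyadic m (t : {ffun 'I_d -> 'I_(2 ^ m)} -> 'I_d -> {i01 R}) g :
  riemann_sum (dyadic_grid m) t g = 2^-1 ^+ (m * d) * \sum_c g (t c).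
Proof.
rewrite /riemann_sum mulr_sumr; apply: eq_bigr => c _; rewrite mulrC.
under eq_bigr do rewrite dyadic_grid_step.
by rewrite prodr_const card_ord exprM.
Qed.

Lemma dyadic_point_ge0 m (i : 'I_(2 ^ m)) : 0 <= i%:R / 2 ^+ m :> R.
Proof. by rewrite divr_ge0// ltW. Qed.

Lemma dyadic_point_le1 m (i : 'I_(2 ^ m)) : i%:R / 2 ^+ m <= 1 :> R.
Proof. by rewrite ler_pdivrMr// mul1r -natrX ler_nat ltnW. Qed.

Definition dyadic_point m (c : {ffun 'I_d -> 'I_(2 ^ m)}) (k : 'I_d) : {i01 R} :=
  Itv01 (dyadic_point_ge0 (c k)) (dyadic_point_le1 (c k)).

Definition in_dyadic_cell m (c : {ffun 'I_d -> 'I_(2 ^ m)}) (y : 'I_d -> {i01 R}) :=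
  forall k, dyadic_grid m k (c k) <= (y k)%:num <= dyadic_grid m k (c k).+1.

Lemma dyadic_point_in_cell m c : in_dyadic_cell c (@dyadic_point m c).
Proof.
move=> k; rewrite /dyadic_grid/= lexx/=.
by rewrite ler_pM2r ?invr_gt0// ler_nat.
Qed.

Lemma cell_of_point m (y : 'I_d -> {i01 R}) :
  exists c : {ffun 'I_d -> 'I_(2 ^ m)}, in_dyadic_cell c y.
Proof.
(* The minimum puts a coordinate equal to 1 into the last cell. *)
have pos k : (minn (Num.truncn ((y k)%:num * 2 ^+ m)) (2 ^ m).-1 < 2 ^ m)%N.
  by rewrite (leq_ltn_trans (geq_minr _ _))// ltn_predL expn_gt0.
exists [ffun k => Ordinal (pos k)] => k; rewrite ffunE /dyadic_grid/=.
have y0 : 0 <= (y k)%:num :> R by [].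
have y1 : (y k)%:num <= 1 :> R by [].
have Y0 : 0 <= (y k)%:num * 2 ^+ m by rewrite mulr_ge0// ltW.
have /andP[t1 t2] := truncn_itv Y0.
rewrite ler_pdivrMr// ler_pdivlMr//; apply/andP; split.
  by apply: le_trans t1; rewrite ler_nat geq_minl.
case: (leqP (Num.truncn ((y k)%:num * 2 ^+ m)) (2 ^ m).-1) => H; first exact: ltW.
by rewrite prednK ?expn_gt0// natrX ler_piMl// ltW.
Qed.

Lemma riemann_integrable_dyadic g : riemann_integrable g ->
  forall eps : R, 0 < eps -> exists m0, forall m, (m0 <= m)%N ->
  forall s t, dyadic_tagging (m := m) s -> dyadic_tagging (m := m) t ->
  `|2^-1 ^+ (m * d) * (\sum_c g (s c) - \sum_c g (t c))| < eps.
Proof.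
move=> [I HI] e e0.
have [delta d0 Hd] := HI _ (divr_gt0 e0 (ltr0Sn R 1)).
have c0 : (2^-1 : R) ^+ m @[m --> \oo] --> 0.
  by apply: cvg_expr; rewrite ger0_norm; lra.
have /cvgrPdist_lt/(_ _ d0)[m0 _ Hm] := c0.
exists m0 => m m0m s t ss tt.
have mesh : mesh_lt (2 ^ m) (dyadic_grid m) delta.
  move=> k i _; rewrite dyadic_grid_step.
  have := Hm m m0m; rewrite /= sub0r normrN.
  exact: le_lt_trans (ler_norm _).
have := Hd _ _ _ (@is_grid_dyadic m) mesh ss.
have := Hd _ _ _ (@is_grid_dyadic m) mesh tt.
rewrite !riemann_sum_dyadic mulrBr.
set A := 2^-1 ^+ _ * (\sum_c g (t c)).
set B := 2^-1 ^+ _ * (\sum_c g (s c)) => h1 h2.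
rewrite (_ : B - A = (B - I) - (A - I)); last lra.
by rewrite (le_lt_trans (ler_normB _ _))//; lra.
Qed.

(* Exchanging the two tags in the cells where the difference is negative turns a
   difference of two Riemann sums into a sum of absolute values. *)
Lemma riemann_oscillation g : riemann_integrable g ->
  forall eps : R, 0 < eps -> exists m0, forall m, (m0 <= m)%N ->
  forall t, dyadic_tagging (m := m) t ->
  2^-1 ^+ (m * d) * (\sum_c `|g (dyadic_point c) - g (t c)|) <= eps.
Proof.
move=> rg e e0; have [m0 H] := riemann_integrable_dyadic rg e0.
exists m0 => m m0m t tt.
pose P c := g (t c) <= g (@dyadic_point m c).
pose s1 c := if P c then @dyadic_point m c else t c.
pose s2 c := if P c then t c else @dyadic_point m c.
have h1 : dyadic_tagging s1.
  by move=> c k; rewrite /s1; case: ifP => _; [exact: dyadic_point_in_cell|exact: tt].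
have h2 : dyadic_tagging s2.
  by move=> c k; rewrite /s2; case: ifP => _; [exact: tt|exact: dyadic_point_in_cell].
have := H m m0m _ _ h1 h2.
rewrite -sumrB (eq_bigr (fun c => `|g (dyadic_point c) - g (t c)|)); last first.
  move=> c _; rewrite /s1 /s2; case: ifP => Pc.
    by rewrite ger0_norm// subr_ge0.
  by rewrite ler0_norm ?opprB// subr_le0 ltW// ltNge; apply: negbT.
by move=> /ltW; apply: le_trans; exact: ler_norm.
Qed.

(** On one fixed grid, moving a single tag to [y] changes the Riemann sum by the cell volume times
    the change of [g], and by less than 1. So [g y] is within the inverse volume of one of finitely
    many values. *)
Lemma riemann_bounded g : riemann_integrable g ->
  exists2 M : R, 0 <= M & forall y, `|g y| <= M.
Proof.
move=> rg; have [m H] := riemann_integrable_dyadic rg ltr01.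
have q0 : 0 < 2^-1 ^+ (m * d) :> R by rewrite exprn_gt0// invr_gt0.
exists (\sum_c `|g (@dyadic_point m c)| + (2^-1 ^+ (m * d))^-1).
  by rewrite addr_ge0 ?sumr_ge0// invr_ge0 ltW.
move=> y; have [c yc] := cell_of_point m y.
pose s c' := if c' == c then y else @dyadic_point m c'.
have hs : dyadic_tagging s.
  move=> c' k; rewrite /s; case: eqP => [->|_]; first exact: yc.
  exact: dyadic_point_in_cell.
have := H m (leqnn m) _ _ hs (@dyadic_point_in_cell m).
rewrite -sumrB (bigD1 c)//= big1 ?addr0; last first.
  by move=> c' /negbTE cc'; rewrite /s cc' subrr.
rewrite /s eqxx normrM (gtr0_norm q0) -ltr_pdivlMl// mulr1 => h.
rewrite (bigD1 c)//=.
have : 0 <= \sum_(i | i != c) `|g (@dyadic_point m i)| by exact: sumr_ge0.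
have := ler_normD (g y - g (dyadic_point c)) (g (dyadic_point c)).
rewrite subrK; lra.
Qed.

(** A tagging that almost attains the largest deviation in every cell turns [riemann_oscillation], a
    bound for each tagging, into a bound valid at all points of the cells. *)
Lemma near_sup_tagging g m eps : riemann_integrable g -> 0 < eps ->
  exists2 t, dyadic_tagging (m := m) t & forall c y, in_dyadic_cell c y ->
  `|g (dyadic_point c) - g y| <= `|g (dyadic_point c) - g (t c)| + eps.
Proof.
move=> rg e0; have [M M0 gM] := riemann_bounded rg.
suff H (c : {ffun 'I_d -> 'I_(2 ^ m)}) : exists t, in_dyadic_cell c t /\
    forall y, in_dyadic_cell c y ->
    `|g (dyadic_point c) - g y| <= `|g (dyadic_point c) - g t| + eps.
  have [t Ht] := choice H.
  by exists t => [c|c y yc]; [exact: (Ht c).1|exact: (Ht c).2].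
pose A : set R := [set v | exists2 y, in_dyadic_cell c y & v = `|g (dyadic_point c) - g y|].
have supA : has_sup A.
  split; first by exists `|g (dyadic_point c) - g (dyadic_point c)|, (dyadic_point c);
    [exact: dyadic_point_in_cell|].
  exists (M + M) => _ [y _ ->].
  by rewrite (le_trans (ler_normB _ _))// lerD.
have [_ [t tc ->] ht] := sup_adherent e0 supA.
exists t; split => // y yc.
have := ub_le_sup supA.2 (ex_intro2 _ _ y yc erefl); lra.
Qed.

End riemann_dyadic.

(** * Dyadic cells addressed by bits *)

Section dyadic_cells.
Context {R : realType}.

Fixpoint dyadic_num (b : nat -> bool) (m : nat) : nat :=
  if m is m'.+1 then (dyadic_num b m').*2 + b m else 0.

Lemma dyadic_num_lt b m : (dyadic_num b m < 2 ^ m)%N.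
Proof. by elim: m => //= m IH; rewrite expnS; case: (b _); lia. Qed.

Lemma dyadicE b m : dyadic R b m = (dyadic_num b m)%:R / 2 ^+ m.
Proof.
elim: m => [|m IH]; first by rewrite /dyadic big_geq// mul0r.
rewrite dyadicS IH /= natrD -muln2 natrM exprS.
by field; rewrite expf_neq0.
Qed.

Definition dyadic_cell (d m : nat) (b : bit_array) : {ffun 'I_d -> 'I_(2 ^ m)} :=
  [ffun k : 'I_d => Ordinal (dyadic_num_lt (b ^~ k) m)].

Lemma bit_meanMl s (h h' : bit_array -> R) b :
  (forall k v c, k \in s -> h' (flip c k v) = h' c) ->
  bit_mean s (fun c => h c * h' c) b = bit_mean s h b * h' b.
Proof.
elim: s b => // k s IH b hs; rewrite !bit_mean_cons !IH; first last.
- by move=> l v c ls; apply: hs; rewrite inE ls orbT.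
- by move=> l v c ls; apply: hs; rewrite inE ls orbT.
by rewrite !hs ?mem_head// -mulrDl mulrAC.
Qed.

Lemma bit_mean_cell_column m j (i : nat) b : (i < 2 ^ m)%N ->
  bit_mean (column j m) (fun c => (dyadic_num (c ^~ j) m == i)%:R) b =
  2^-1 ^+ m :> R.
Proof.
move=> im; have p0 : 2 ^+ m != 0 :> R by rewrite expf_neq0.
have inj (k l : nat) : (k%:R / 2 ^+ m == l%:R / 2 ^+ m :> R) = (k == l).
  apply/eqP/eqP => [|->//] /(congr1 (fun z => z * 2 ^+ m)).
  by rewrite !divfK// => /eqP; rewrite eqr_nat => /eqP.
have -> : (fun c : bit_array => (dyadic_num (c ^~ j) m == i)%:R : R) =
    (fun c => (dyadic R (c ^~ j) m == i%:R / 2 ^+ m)%:R).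
  by apply/funext => c; rewrite dyadicE inj.
rewrite (bit_mean_column j m (fun y => (y == i%:R / 2 ^+ m)%:R)).
under eq_bigr do rewrite inj.
rewrite big_mkord (bigD1 (Ordinal im))//= eqxx big1 ?addr0 ?mulr1//.
by move=> k; rewrite -val_eqE/= => /negbTE ->.
Qed.

Lemma bit_mean_cells m d (i : nat -> nat) b : (forall j, i j < 2 ^ m)%N ->
  bit_mean (columns d m)
    (fun c => \prod_(j < d) (dyadic_num (c ^~ j) m == i j)%:R) b =
  2^-1 ^+ (m * d) :> R.
Proof.
move=> im; elim: d b => [|d IH] b.
  by rewrite /= big_ord0 muln0 expr0.
rewrite columnsS bit_mean_cat.
have -> : bit_mean (columns d m) (fun c => \prod_(j < d.+1)
      (dyadic_num (c ^~ j) m == i j)%:R) =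
    fun c => 2^-1 ^+ (m * d) * (dyadic_num (c ^~ d) m == i d)%:R :> R.
  apply/funext => c.
  under eq_fun do rewrite big_ord_recr/=.
  rewrite (@bit_meanMl _ _ (fun c => (dyadic_num (c ^~ d) m == i d)%:R)) ?IH//.
  move=> k v c'; rewrite mem_columns => /andP[_ kd].
  congr (dyadic_num _ _ == _)%:R; apply/funext => r.
  by rewrite /flip /set_bit [X in _ && X]gtn_eqF// andbF.
by rewrite bit_meanZ bit_mean_cell_column// mulnS exprD mulrC.
Qed.

Lemma bit_mean_dyadic_cell m d (c : {ffun 'I_d -> 'I_(2 ^ m)}) b :
  bit_mean (columns d m) (fun b' => (dyadic_cell d m b' == c)%:R) b =
  2^-1 ^+ (m * d) :> R.
Proof.
pose i (j : nat) : nat := if insub j is Some k then c k else 0%N.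
rewrite -(@bit_mean_cells m d i b); last first.
  by move=> j; rewrite /i; case: insub => [k|]; rewrite ?ltn_ord// expn_gt0.
congr bit_mean; apply/funext => b'.
have iE (j : 'I_d) : i j = c j.
  by rewrite /i insubT// => jd; congr (nat_of_ord (c _)); apply: val_inj.
have [/eqP E|E] := boolP (dyadic_cell d m b' == c).
  by rewrite big1// => j _; rewrite iE -E ffunE/= eqxx.
have [j jE] : exists j : 'I_d, dyadic_num (b' ^~ j) m != c j.
  apply/existsP; apply: contraNT E; rewrite negb_exists => /forallP H.
  apply/eqP/ffunP => j; apply: val_inj; rewrite ffunE/=.
  by have := H j; rewrite negbK => /eqP.
by rewrite (bigD1 j)//= iE (negbTE jE) mul0r.
Qed.

Lemma depends_on_dyadic_cell (V : Type) m d (psi : {ffun 'I_d -> 'I_(2 ^ m)} -> V) t :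
  depends_on (columns d m ++ t) (fun b => psi (dyadic_cell d m b)).
Proof.
move=> b c bc; congr psi; apply/ffunP => k; rewrite !ffunE; apply: val_inj => /=.
have : forall i, (1 <= i <= m)%N -> b i k = c i k.
  move=> i im; apply: (bc (i, k : nat)).
  by rewrite mem_cat mem_columns im ltn_ord.
elim: m {psi bc} => //= m IH bc; rewrite bc ?ltnS ?leqnn// IH// => i /andP[i1 im].
by rewrite bc// i1 (leq_trans im).
Qed.

Lemma dyadic_cell_point m d b (k : 'I_d) :
  (@dyadic_point R d m (dyadic_cell d m b) k)%:num = dyadic R (b ^~ k) m.
Proof. by rewrite dyadicE /= ffunE. Qed.

End dyadic_cells.

(** * Step functions on the cells, under the random bits and under the discrete mean *)

Section riemann_law.
Context d0 (T : measurableType d0) (R : realType) (P : probability T R).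
Variable x : nat -> nat -> {RV P >-> bool}.
Hypothesis xP : iid_symmetric_bits x.
Variables (d m : nat).
Local Notation cell_type := {ffun 'I_d -> 'I_(2 ^ m)}.

Definition cell_event (c : cell_type) : set T :=
  [set w | dyadic_cell d m (bits x w) == c].

Lemma prob_cell_event c : measurable (cell_event c) /\
  P (cell_event c) = (2^-1 ^+ (m * d))%:E.
Proof.
have PT t b : uniq t -> all (fun k : nat * nat => 1 <= k.1)%N t ->
    P (bit_cylinder x t b `&` setT) = (2^-1 ^+ size t * 1)%:E.
  by move=> ut at_; rewrite setIT mulr1; exact: prob_bit_cylinder.
have := @prob_bit_event _ _ _ P x _ setT 1 measurableT PT (columns d m) [::]
   (fun=> xpred0) (fun b => dyadic_cell d m b == c).
rewrite cats0 bit_cylinder_nil !setTI bit_mean_dyadic_cell /= expr0 !mul1r.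
apply.
- exact: uniq_columns.
- by apply/allP => k; rewrite mem_columns => /andP[/andP[]].
- rewrite -[columns _ _]cats0.
  exact: (@depends_on_dyadic_cell _ m d (fun c' => c' == c)).
Qed.

Definition cell_step (a : cell_type -> R) (w : T) : R := a (dyadic_cell d m (bits x w)).

Lemma integral_cell_step (a : cell_type -> R) :
  P.-integrable setT (EFin \o cell_step a) /\
  (\int[P]_w (cell_step a w)%:E = (2^-1 ^+ (m * d) * \sum_c a c)%:E)%E.
Proof.
have mE c : measurable (cell_event c) by case: (prob_cell_event c).
have stepE : EFin \o cell_step a = fun w => (\sum_c (a c * \1_(cell_event c) w)%:E)%E.
  apply/funext => w; rewrite sumEFin /cell_step /=; congr EFin.
  rewrite (bigD1 (dyadic_cell d m (bits x w)))//= indicE mem_set /cell_event/= ?mulr1//.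
  rewrite big1 ?addr0// => c cw; rewrite indicE memNset ?mulr0//=.
  by rewrite eq_sym; exact/negP.
have int1 c : P.-integrable setT (fun w => (a c * \1_(cell_event c) w)%:E).
  have -> : (fun w => (a c * \1_(cell_event c) w)%:E) =
    (fun w => ((a c)%:E * (\1_(cell_event c) w)%:E)%E).
    by apply/funext => w; rewrite EFinM.
  by apply: integrableZl => //; exact: integrable_indic.
rewrite -[X in (X = _)%E]/(\int[P]_w ((EFin \o cell_step a) w))%E stepE.
split; first by apply: integrable_sum.
rewrite integral_sum// mulr_sumr -sumEFin; apply: eq_bigr => c _.
under eq_integral do rewrite EFinM.
rewrite integralZl//; last exact: integrable_indic.
rewrite integral_indic// setIT.
have [_ Pc] := prob_cell_event c.
rewrite mulrC EFinM; congr (_ * _)%E; exact: Pc.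
Qed.

(** The same value as in [integral_cell_step]: for functions of the cell, the discrete mean and the
    expectation under [P] agree, which is the bridge between the two. *)
Lemma bit_mean_cell_step (a : cell_type -> R) b :
  bit_mean (columns d m) (fun c => a (dyadic_cell d m c)) b =
  2^-1 ^+ (m * d) * \sum_c a c.
Proof.
have -> : (fun c => a (dyadic_cell d m c)) =
    fun b' => \sum_c (a c * (dyadic_cell d m b' == c)%:R).
  apply/funext => b'; rewrite (bigD1 (dyadic_cell d m b'))//= eqxx mulr1.
  by rewrite big1 ?addr0// => c; rewrite eq_sym => /negbTE ->; rewrite mulr0.
rewrite bit_mean_sum mulr_sumr; apply: eq_bigr => c _.
by rewrite bit_meanZ bit_mean_dyadic_cell mulrC.
Qed.

End riemann_law.

Section riemann_comparison.
Context d0 (T : measurableType d0) (R : realType) (P : probability T R).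
Variable x : nat -> nat -> {RV P >-> bool}.
Hypothesis xP : iid_symmetric_bits x.
Variable d : nat.
Implicit Types (g : ('I_d -> {i01 R}) -> R) (psi : R -> R).

Lemma binary_in_dyadic_cell m w :
  in_dyadic_cell (dyadic_cell d m (bits x w)) (cube_head (tail_column x 0 w)).
Proof.
move=> k; have H := dyadic_cell_point m (bits x w) k; rewrite /= in H.
rewrite /dyadic_grid H /cube_head/= -natr1 mulrDl H mul1r -exprVn.
by rewrite dyadic_le_binary binary_le_dyadic.
Qed.

Lemma le_integral_between (u v : T -> R) (a b : R) :
  P.-integrable setT (EFin \o u) -> P.-integrable setT (EFin \o v) ->
  (forall w, u w <= v w) -> (\int[P]_w (u w)%:E = a%:E)%E ->
  (\int[P]_w (v w)%:E = b%:E)%E -> a <= b.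
Proof.
move=> iu iv uv ua vb; rewrite -lee_fin -ua -vb; apply: le_integral => // w _.
by rewrite lee_fin.
Qed.

Lemma bounded_integrable (h : T -> R) (M : R) : measurable_fun setT h ->
  (forall w, `|h w| <= M) -> P.-integrable setT (EFin \o h).
Proof.
move=> mh hM.
apply: (@le_integrable _ _ _ P setT measurableT _ (EFin \o cst M)) => //.
- exact/measurable_EFinP.
- move=> w _; rewrite lee_fin (le_trans (hM w))//; exact: ler_norm.
- exact: finite_measure_integrable_cst.
Qed.

(** The discrete mean is the expectation of a step function. For each outcome the random point lies
    in the cell of its truncation, so the error is at most L times a near-supremal oscillation,
    itself a step function of small mean. *)
Lemma bit_mean_riemann_close g psi (M L : R) :
  riemann_integrable g -> 0 <= L -> (forall y, `|g y| <= M) ->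
  (forall a b, `|a| <= M -> `|b| <= M -> `|psi a - psi b| <= L * `|a - b|) ->
  measurable_fun setT (fun w => psi (g (cube_head (tail_column x 0 w)))) ->
  forall eps : R, 0 < eps -> exists m0, forall m b, (m0 <= m)%N ->
  `|bit_mean (columns d m) (fun c => psi (g (dyadic_point (dyadic_cell d m c)))) b -
    \int[P]_w psi (g (cube_head (tail_column x 0 w)))| <= eps.
Proof.
move=> rg L0 gM psiL mpsi e e0.
(* The error will be at most L (e' + e'): one e' for the oscillation, one for the near-supremum. The
   1 covers L = 0. *)
pose e' := e / (2 * (L + 1)).
have L1 : 0 < 2 * (L + 1) by lra.
have e'0 : 0 < e' by rewrite divr_gt0.
have eE : e = 2 * (L + 1) * e' by rewrite /e'; field; lra.
have [m0 Hosc] := riemann_oscillation rg e'0.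
exists m0 => m b m0m.
have [t tt tsup] := near_sup_tagging m rg e'0.
pose q : R := 2^-1 ^+ (m * d).
have q0 : 0 < q by rewrite exprn_gt0// invr_gt0.
pose a c := psi (g (@dyadic_point R d m c)).
pose u c := L * (`|g (dyadic_point c) - g (t c)| + e').
have qu : q * \sum_c u c <= e.
  rewrite -mulr_sumr big_split/= sumr_const card_ffun !card_ord -[e' *+ _]mulr_natl.
  have qn : q * ((2 ^ m) ^ d)%:R = 1.
    by rewrite /q -expnM natrX -exprMn mulVf ?expr1n.
  have := Hosc m m0m t tt; rewrite -/q => H.
  rewrite mulrCA mulrDr mulrA qn mul1r eE.
  apply: (@le_trans _ _ (L * (e' + e'))); first by rewrite ler_wpM2l// lerD2r.
  by nra.
have M0 : 0 <= M by rewrite (le_trans _ (gM (fun=> 0%:i01))).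
pose h w := psi (g (cube_head (tail_column x 0 w))).
have ih : P.-integrable setT (EFin \o h).
  apply: (@bounded_integrable _ (`|psi 0| + L * M)) => // w.
  have := psiL (g (cube_head (tail_column x 0 w))) 0 (gM _).
  rewrite normr0 subr0 => /(_ M0) H.
  rewrite -[h w](subrK (psi 0)) addrC (le_trans (ler_normD _ _))// lerD2l.
  by rewrite (le_trans H)// ler_wpM2l.
have ihE : (\int[P]_w (h w)%:E = (\int[P]_w h w)%:E)%E.
  by rewrite /Rintegral fineK//; exact: integrable_fin_num.
rewrite (bit_mean_cell_step (m := m) a b) -/q.
have au w : `|a (dyadic_cell d m (bits x w)) - h w| <= u (dyadic_cell d m (bits x w)).
  rewrite /a /h /u (le_trans (psiL _ _ (gM _) (gM _)))// ler_wpM2l//.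
  by apply: tsup; exact: binary_in_dyadic_cell.
have [i1 I1] := integral_cell_step xP (fun c => a c - u c).
have [i2 I2] := integral_cell_step xP (fun c => a c + u c).
have H1 := le_integral_between i1 ih _ I1 ihE.
have H2 := le_integral_between ih i2 _ ihE I2.
have {}H1 : q * (\sum_c a c) - q * (\sum_c u c) <= \int[P]_w h w.
  rewrite -mulrBr -sumrB; apply: H1 => w; rewrite /cell_step.
  by have := au w; rewrite ler_norml => /andP[_]; lra.
have {}H2 : \int[P]_w h w <= q * (\sum_c a c) + q * (\sum_c u c).
  rewrite -mulrDr -big_split; apply: H2 => w; rewrite /cell_step.
  by have := au w; rewrite ler_norml => /andP[+ _]; lra.
by rewrite ler_norml -/(h _); apply/andP; split; lra.
Qed.

Variable lam : probability (cube R) R.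
Hypothesis lamP : is_lebesgue_product lam.

Lemma tail_law B : measurable B -> pushforward P (tail_column x 0) B = lam B.
Proof.
move=> mB; have := @prob_tail_column _ _ _ P x xP lam lamP 0 [::] (fun=> xpred0) B.
by rewrite bit_cylinder_nil setTI expr0 mul1e; apply.
Qed.

Lemma ge0_integral_tail_law (h : cube R -> \bar R) : measurable_fun setT h ->
  (forall y, 0 <= h y)%E ->
  (\int[P]_w h (tail_column x 0 w) = \int[lam]_y h y)%E.
Proof.
move=> mh h0; have mt := measurable_tail_column x 0.
transitivity (\int[pushforward P (tail_column x 0)]_y h y)%E.
  by rewrite ge0_integral_pushforward.
by apply: eq_measure_integral => A mA _; exact: tail_law.
Qed.

Lemma integral_tail_law (h : cube R -> R) : lam.-integrable setT (EFin \o h) ->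
  (\int[P]_w (h (tail_column x 0 w))%:E = \int[lam]_y (h y)%:E)%E.
Proof.
move=> ih; have mt := measurable_tail_column x 0.
have mh : measurable_fun setT h by apply/measurable_EFinP; exact: measurable_int ih.
transitivity (\int[pushforward P (tail_column x 0)]_y (h y)%:E)%E; last first.
  by apply: eq_measure_integral => A mA _; exact: tail_law.
have mht : measurable_fun setT (h \o tail_column x 0) by exact: measurableT_comp mh mt.
rewrite integral_pushforward//; first exact/measurable_EFinP.
rewrite preimage_setT; apply/integrableP; split; first exact/measurable_EFinP.
have := @ge0_integral_tail_law (fun y => `|(h y)%:E|%E).
move=> /(_ _ _) E.
rewrite E//; last by apply: measurableT_comp => //; exact/measurable_EFinP.
by case/integrableP: ih.
Qed.

End riemann_comparison.

(** * The inequality at finite level and its limit *)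

Section finite_level.
Context d (T : measurableType d) (R : realType) (P : probability T R).
Variable x : nat -> nat -> {RV P >-> bool}.
Hypothesis xP : iid_symmetric_bits x.
Variable lam : probability (cube R) R.
Hypothesis lamP : is_lebesgue_product lam.
Variable f : cube R -> R.
Hypothesis mf : measurable_fun setT f.
Variable n : nat.
Hypothesis ifs : forall y : 'I_n.+1 -> {i01 R},
  lam.-integrable setT (fun z => (f (splice y z))%:E).
Variable m : nat.

Local Notation bits_mn := (columns n.+1 m).

Definition grid_point (b : bit_array) : 'I_n.+1 -> {i01 R} :=
  dyadic_point (dyadic_cell n.+1 m b).

Definition grid_mean (b : bit_array) : R := tail_integral lam f (grid_point b).

Lemma Xseq_splice b (z : cube R) :
  (forall j, (z j)%:num = binary R (b ^~ (n.+1 + j)%N)) ->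
  Xseq R m n b = splice (grid_point b) z.
Proof.
move=> zE; apply/funext => j; apply: val_inj; rewrite /Xseq.
have [jn|jn] := leqP j n.
  rewrite (splice_lt _ _ (jn : (j < n.+1)%N)).
  exact/esym/(dyadic_cell_point m b (Ordinal (jn : (j < n.+1)%N))).
by rewrite splice_ge//=; have := zE (j - n.+1)%N; rewrite subnKC.
Qed.

Lemma grid_point_depends : depends_on bits_mn grid_point.
Proof.
have := @depends_on_dyadic_cell _ m n.+1 (@dyadic_point R n.+1 m) [::].
by rewrite cats0.
Qed.

Lemma bits_mn_row1 k : k \in bits_mn -> (1 <= k.1)%N && (k.2 < n.+1)%N.
Proof. by rewrite mem_columns => /andP[/andP[-> _] ->]. Qed.

(** The flipped bit lies in one of the first n + 1 columns, so the tail is unaffected. *)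
Lemma Xseq_flip k v w : k \in bits_mn ->
  Xseq R m n (flip (bits x w) k v) =
  splice (grid_point (flip (bits x w) k v)) (tail_column x n.+1 w).
Proof.
move=> /bits_mn_row1/andP[_ kn]; apply: Xseq_splice => j /=.
congr (binary R _); apply/funext => i; rewrite /flip /set_bit.
by rewrite [X in _ && X]gtn_eqF ?andbF// (leq_trans kn)// leq_addr.
Qed.

Lemma integral_bit (k : nat * nat) (phi : bool -> R) : (1 <= k.1)%N ->
  (\int[P]_w (phi (x k.1 k.2 w))%:E = ((phi true + phi false) / 2)%:E)%E.
Proof.
move=> k1; pose E := [set w | x k.1 k.2 w = true].
have mE : measurable E by exact: measurable_bit_eq.
have PE : P E = (2^-1)%:E.
  have := @prob_bit_cylinder _ _ _ P x xP [:: k] (fun=> xpredT).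
  by rewrite bit_cylinder_cons bit_cylinder_nil setIT/= k1 expr1; apply.
have -> : (fun w => (phi (x k.1 k.2 w))%:E) =
    (fun w => ((cst (phi false) w)%:E + (phi true - phi false)%:E * (\1_E w)%:E)%E).
  apply/funext => w; rewrite -EFinM -EFinD indicE; congr EFin.
  case xw : (x k.1 k.2 w).
    by rewrite mem_set //= mulr1 addrC subrK.
  by rewrite memNset ?mulr0 ?addr0// /E/= xw.
rewrite integralD//; last 2 first.
- exact: finite_measure_integrable_cst.
- by apply: integrableZl => //; exact: integrable_indic.
have -> : (\int[P]_w (cst (phi false) w)%:E)%E = (phi false)%:E.
  transitivity ((phi false)%:E * P setT)%E.
    exact: (integral_cst P measurableT (phi false)%:E).
  by rewrite probability_setT mule1.
rewrite integralZl//; last exact: integrable_indic.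
rewrite integral_indic// setIT.
have -> : ((phi true - phi false)%:E * P E)%E = ((phi true - phi false) / 2)%:E.
  by rewrite EFinM; congr (_ * _)%E; exact: PE.
by rewrite -EFinD; congr EFin; field.
Qed.

(** The bit difference with the tail frozen at [z]. At the random tail it is [Delta]; integrated
    over [z] it is the bit difference of f_n on the grid. Jensen's inequality compares the two. *)
Definition section_diff (k : nat * nat) (b : bit_array) (z : cube R) : R :=
  bit_diff k (fun c => f (splice (grid_point c) z)) b.

Lemma Delta_section_diff k w : k \in bits_mn ->
  Delta x f m n k.1 k.2 w = section_diff k (bits x w) (tail_column x n.+1 w).
Proof.
move=> kmn; have /andP[k1 _] := bits_mn_row1 kmn.
rewrite /Delta /expectation_bit unlock.
rewrite (integral_bit (fun v => f (Xseq R m n (flip (bits x w) k v))) k1)/=.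
rewrite /section_diff /bit_diff /bit_avg !Xseq_flip//; congr (f _ - _).
exact: Xseq_splice.
Qed.

Lemma measurable_section b : measurable_fun setT (fun z => f (splice (grid_point b) z)).
Proof. exact: measurableT_comp mf (measurable_splice _). Qed.

Lemma measurable_section_diff k b : measurable_fun setT (section_diff k b).
Proof.
apply: measurable_funB; first exact: measurable_section.
by apply: measurable_funM => //; apply: measurable_funD; exact: measurable_section.
Qed.

(** Joint measurability in bits and tail is read off X^{m,n}, taken at the random bits and at their
    two modifications in [k]. *)
Lemma measurable_Delta k : k \in bits_mn ->
  measurable_fun setT (fun w => section_diff k (bits x w) (tail_column x n.+1 w)).
Proof.
move=> kmn.
have mX v : measurable_fun setT (fun w => f (Xseq R m n (flip (bits x w) k v))).
  apply: measurableT_comp mf _; apply: measurable_Xseq; apply: measurable_flip.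
  exact: measurable_bits.
have mX0 : measurable_fun setT (fun w => f (Xseq R m n (bits x w))).
  by apply: measurableT_comp mf _; apply: measurable_Xseq; exact: measurable_bits.
apply: (eq_measurable_fun (fun w => f (Xseq R m n (bits x w)) -
  (f (Xseq R m n (flip (bits x w) k true)) +
   f (Xseq R m n (flip (bits x w) k false))) / 2)).
  move=> w _; rewrite !Xseq_flip//; congr (f _ - _).
  exact: Xseq_splice.
by apply: measurable_funB => //; apply: measurable_funM => //; exact: measurable_funD.
Qed.

Lemma section_diff_depends k : depends_on bits_mn (section_diff k).
Proof.
move=> b c bc; apply/funext => z; rewrite /section_diff /bit_diff /bit_avg.
have H v : grid_point (flip b k v) = grid_point (flip c k v).
  by apply: grid_point_depends => l ls; rewrite !flipE bc.
by rewrite !H (grid_point_depends bc).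
Qed.

Lemma integrable_section_diff k b : lam.-integrable setT (EFin \o section_diff k b).
Proof.
have -> : EFin \o section_diff k b = (fun z =>
   ((f (splice (grid_point b) z))%:E -
    ((2^-1)%:E * ((f (splice (grid_point (flip b k true)) z))%:E +
       (f (splice (grid_point (flip b k false)) z))%:E)))%E).
  by apply/funext => z; rewrite /= /section_diff /bit_diff /bit_avg mulrC EFinB EFinM EFinD.
by apply: integrableB => //; apply: integrableZl => //; apply: integrableD.
Qed.

Lemma Rintegral_section_diff k b :
  \int[lam]_z section_diff k b z = bit_diff k grid_mean b.
Proof.
rewrite /Rintegral; under eq_integral => z _.
  rewrite /section_diff /bit_diff /bit_avg mulrC EFinB EFinM EFinD. over.
rewrite integralB//; last by apply: integrableZl => //; apply: integrableD.
rewrite integralZl//; last by apply: integrableD.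
rewrite integralD//.
have fin (y : 'I_n.+1 -> {i01 R}) : (\int[lam]_z (f (splice y z))%:E)%E \is a fin_num.
  exact: (integrable_fin_num measurableT (ifs y)).
have E (y : 'I_n.+1 -> {i01 R}) :
    (\int[lam]_z (f (splice y z))%:E)%E = (tail_integral lam f y)%:E.
  by rewrite /tail_integral /Rintegral fineK.
by rewrite !E -EFinD /= /bit_diff /bit_avg mulrC.
Qed.

Lemma mean_norm_Delta k b0 : k \in bits_mn ->
  ((bit_mean bits_mn (fun b => `|bit_diff k grid_mean b|) b0)%:E <=
   'E_P[fun w => (`|Delta x f m n k.1 k.2 w| ^+ 1)%R])%E.
Proof.
move=> kmn; rewrite unlock.
under eq_integral do rewrite Delta_section_diff// expr1.
have := @le_integral_tail_column _ _ _ P x xP lam lamP n.+1 bits_mn [::] b0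
  (fun b z => (`|section_diff k b z|)%:E) (fun b => `|bit_diff k grid_mean b|).
rewrite cats0 bit_cylinder_nil expr0 mul1r; apply.
- exact: uniq_columns.
- by apply/allP => l /bits_mn_row1.
- move=> c; apply/measurable_EFinP; apply: measurableT_comp => //.
  exact: measurable_section_diff.
- by move=> c z; rewrite lee_fin.
- apply/measurable_EFinP; apply: measurableT_comp => //.
  exact: measurable_Delta.
- by move=> b c bc; rewrite (section_diff_depends k bc).
- move=> c; rewrite -Rintegral_section_diff.
  have i1 := integrable_section_diff k c.
  have := le_abse_integral lam measurableT (measurable_int lam i1).
  by rewrite -[X in `|X|%E]fineK ?integrable_fin_num.
Qed.

Lemma mean_sqr_Delta k b0 : k \in bits_mn ->
  ((bit_mean bits_mn (fun b => bit_diff k grid_mean b ^+ 2) b0)%:E <=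
   'E_P[fun w => (`|Delta x f m n k.1 k.2 w| ^+ 2)%R])%E.
Proof.
move=> kmn; rewrite unlock.
under eq_integral do rewrite Delta_section_diff// real_normK ?num_real//.
have := @le_integral_tail_column _ _ _ P x xP lam lamP n.+1 bits_mn [::] b0
  (fun b z => (section_diff k b z ^+ 2)%:E) (fun b => bit_diff k grid_mean b ^+ 2).
rewrite cats0 bit_cylinder_nil expr0 mul1r; apply.
- exact: uniq_columns.
- by apply/allP => l /bits_mn_row1.
- move=> c; apply/measurable_EFinP; apply: measurable_funX.
  exact: measurable_section_diff.
- by move=> c z; rewrite lee_fin sqr_ge0.
- apply/measurable_EFinP; apply: measurable_funX.
  exact: measurable_Delta.
- by move=> b c bc; rewrite (section_diff_depends k bc).
- move=> c; rewrite -Rintegral_section_diff.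
  exact: (sqr_Rintegral_le (integrable_section_diff k c)).
Qed.

Definition level_sum (p : nat) : \bar R :=
  (\sum_(0 <= j < n.+1) \sum_(1 <= i < m.+1)
      'E_P[fun w => (`|Delta x f m n i j w| ^+ p)%R] `^ (2 / p%:R))%E.

Lemma level_sum_columns p : level_sum p =
  (\sum_(k <- bits_mn) 'E_P[fun w => (`|Delta x f m n k.1 k.2 w| ^+ p)%R] `^ (2 / p%:R))%E.
Proof. by rewrite /level_sum /columns big_allpairs_dep. Qed.

Definition level_variance (b0 : bit_array) : R :=
  bit_mean bits_mn (fun b => grid_mean b ^+ 2) b0 - bit_mean bits_mn grid_mean b0 ^+ 2.

(** Both uses of Jensen go the right way: the discrete first moments, subtracted with weight
    [lambda], are at most those of [Delta], hence at most [a]; the discrete energy is at most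
    [level_sum 2]. *)
Lemma level_inequality b0 (a lambda : R) : 0 < lambda ->
  (level_sum 1 <= a%:E)%E ->
  (((level_variance b0 * (1 + ln lambda) - lambda * a) / 2)%:E <= level_sum 2)%E.
Proof.
move=> l0; rewrite !level_sum_columns => sa.
have := @falik_samorodnitsky R bits_mn grid_mean b0 lambda (uniq_columns _ _) l0.
rewrite -/(level_variance b0).
set A := \sum_(k <- _) _; set B := \sum_(k <- _) _ => FS.
have Aa : A <= a.
  rewrite -lee_fin; apply: le_trans sa; rewrite /A -sumEFin.
  rewrite big_seq [leRHS]big_seq; apply: lee_sum => k kmn.
  rewrite divr1 -[X in (X%:E <= _)%E]powR_mulrn; last exact: bit_mean_ge0.
  rewrite -poweR_EFin; apply: gt0_ler_poweR => //.
  - by rewrite in_itv/= leey andbT lee_fin bit_mean_ge0.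
  - rewrite in_itv/= leey andbT; apply: le_trans (mean_norm_Delta b0 kmn).
    by rewrite lee_fin bit_mean_ge0.
  - exact: mean_norm_Delta.
have BB : (B%:E <= \sum_(k <- bits_mn)
    'E_P[fun w => (`|Delta x f m n k.1 k.2 w| ^+ 2)%R] `^ (2 / 2%:R))%E.
  rewrite /B -sumEFin big_seq [leRHS]big_seq; apply: lee_sum => k kmn.
  rewrite divff ?pnatr_eq0// poweRe1; first exact: mean_sqr_Delta.
  apply: le_trans (mean_sqr_Delta b0 kmn).
  by rewrite lee_fin; apply: bit_mean_ge0 => c; exact: sqr_ge0.
apply: le_trans BB; rewrite lee_fin.
have : lambda * A <= lambda * a by rewrite ler_pM2l.
lra.
Qed.

End finite_level.

(** * Convergence of the variance on the grid *)

Section variance_limit.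
Context d (T : measurableType d) (R : realType) (P : probability T R).
Variable x : nat -> nat -> {RV P >-> bool}.
Hypothesis xP : iid_symmetric_bits x.
Variable lam : probability (cube R) R.
Hypothesis lamP : is_lebesgue_product lam.
Variable f : cube R -> R.
Hypothesis mf : measurable_fun setT f.
Hypothesis if2 : lam.-integrable setT (fun y => (f y ^+ 2)%:E).
Hypothesis ifs : forall (n : nat) (y : 'I_n.+1 -> {i01 R}),
  lam.-integrable setT (fun z => (f (splice y z))%:E).
Hypothesis rf : forall n : nat, riemann_integrable (tail_integral lam f (n := n)).

Let mean : R := \int[lam]_y f y.

(** Used with the identity and the square. As the square is only locally Lipschitz, the constant
    [L M] depends on a bound M of f_n, which Riemann integrability provides. *)
Lemma bit_mean_grid_cvg n (psi : R -> R) (L : R -> R) :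
  (forall M, 0 <= M -> 0 <= L M) ->
  (forall M a b, 0 <= M -> `|a| <= M -> `|b| <= M ->
     `|psi a - psi b| <= L M * `|a - b|) ->
  measurable_fun setT psi ->
  forall eps : R, 0 < eps -> exists m0, forall m b, (m0 <= m)%N ->
  `|bit_mean (columns n.+1 m) (fun c => psi (grid_mean lam f n m c)) b -
    \int[lam]_y psi (tail_mean lam f n.+1 y)| <= eps.
Proof.
move=> L0 psiL mpsi e e0.
have [M M0 gM] := riemann_bounded (rf n).
have ifs' y := @ifs n (cube_head y).
have mt := measurable_tail_mean mf ifs'.
have mpt : measurable_fun setT (fun y => psi (tail_mean lam f n.+1 y)).
  exact: measurableT_comp mpsi mt.
have iF : lam.-integrable setT (EFin \o (fun y => psi (tail_mean lam f n.+1 y))).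
  apply: (@bounded_integrable _ _ _ lam _ (`|psi 0| + L M * M)) => // y.
  have tM : `|tail_mean lam f n.+1 y| <= M := gM (cube_head y).
  have := psiL M (tail_mean lam f n.+1 y) 0 M0 tM.
  rewrite normr0 subr0 => /(_ M0) H.
  rewrite -[psi (tail_mean _ _ _ _)](subrK (psi 0)) addrC (le_trans (ler_normD _ _))//.
  by rewrite lerD2l (le_trans H)// ler_wpM2l// L0.
have [|m0 H] := @bit_mean_riemann_close _ _ _ P x xP n.+1 _ psi M (L M) (rf n)
    (L0 _ M0) gM (fun a b => psiL M a b M0) _ e e0.
  apply: (@measurableT_comp _ _ _ _ _ _ (fun y => psi (tail_mean lam f n.+1 y))) => //.
  exact: measurable_tail_column.
exists m0 => m b m0m; have := H m b m0m.
congr (`|_ - _| <= _); rewrite /Rintegral; congr fine.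
exact: (integral_tail_law xP lamP iF).
Qed.

(** The rank of [m] depends on [n], as in the iterated upper limits. Half of the error comes from
    averaging over the tail, half from the grid. *)
Lemma level_variance_cvg (v : R) :
  v = fine (\int[lam]_y (f y ^+ 2)%:E)%E - mean ^+ 2 ->
  forall eps : R, 0 < eps -> exists n0, forall n, (n0 <= n)%N ->
  exists m0, forall m, (m0 <= m)%N ->
  `|level_variance lam f n m (fun=> xpred0) - v| <= eps.
Proof.
move=> vE e e0.
have e2 : 0 < e / 2 by lra.
have f2fin : (\int[lam]_y (f y ^+ 2)%:E)%E \is a fin_num by exact: integrable_fin_num.
have [d0 [k [mk hk sk]]] := cylinder_approximable_sqr_integrable mf if2 e2.
exists d0 => n d0n.
have ifs' y := @ifs n (cube_head y).
have mt := measurable_tail_mean mf ifs'.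
pose S := (\int[lam]_y (tail_mean lam f n.+1 y ^+ 2)%:E)%E.
have Sle : (S <= \int[lam]_y (f y ^+ 2)%:E)%E by exact: integral_sqr_tail_mean_le.
have S0 : (0 <= S)%E by apply: integral_ge0 => y _; rewrite lee_fin sqr_ge0.
have Sfin : S \is a fin_num.
  by rewrite ge0_fin_numE// (le_lt_trans Sle)// ltey_eq f2fin.
have Sge : (\int[lam]_y (f y ^+ 2)%:E <= S + (e / 2)%:E)%E.
  apply: (le_trans (integral_sqr_tail_mean_ge lamP mf ifs' mk
    (head_dependent_le (leqW d0n) hk))).
  by rewrite leeD2l.
have {}Sle : fine S <= fine (\int[lam]_y (f y ^+ 2)%:E)%E by exact: fine_le.
have {}Sge : fine (\int[lam]_y (f y ^+ 2)%:E)%E <= fine S + e / 2.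
  by rewrite -lee_fin EFinD !fineK.
have meanE : \int[lam]_y tail_mean lam f n.+1 y = mean.
  by rewrite /Rintegral (integral_tail_mean lamP mf if2 ifs').
(* The bound by 1 keeps the grid mean within |mean| + 1, so its square errs by at most 2 (|mean| +
   1) eta; the second moment adds one more eta. *)
pose eta := Num.min 1 (e / 2 / (2 * (`|mean| + 1) + 1)).
have D0 : 0 < 2 * (`|mean| + 1) + 1 by have := normr_ge0 mean; lra.
have eta0 : 0 < eta by rewrite lt_min ltr01 divr_gt0.
have eta1 : eta <= 1 by rewrite ge_min lexx.
have eta2 : eta * (2 * (`|mean| + 1) + 1) <= e / 2.
  by rewrite -ler_pdivlMr// ge_min lexx orbT.
have [m1 H1] := @bit_mean_grid_cvg n id (fun=> 1) (fun _ _ => ler01)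
  (fun M a b _ _ _ => eq_ind_r (fun z => `|a - b| <= z) (lexx _) (mul1r _))
  (@measurable_id _ _ _) _ eta0.
have sqrL (M a b : R) : 0 <= M -> `|a| <= M -> `|b| <= M ->
    `|a ^+ 2 - b ^+ 2| <= 2 * M * `|a - b|.
  move=> M0 aM bM; rewrite subr_sqr normrM mulrC ler_wpM2r//.
  by rewrite (le_trans (ler_normD _ _))//; lra.
have [m2 H2] := @bit_mean_grid_cvg n (fun z => z ^+ 2) (fun M => 2 * M)
  (fun M M0 => mulr_ge0 (ler0n _ 2) M0) sqrL (@exprn_measurable _ _ 2) _ eta0.
exists (maxn m1 m2) => m; rewrite geq_max => /andP[m1m m2m].
have := H1 m (fun=> xpred0) m1m; have := H2 m (fun=> xpred0) m2m.
rewrite meanE /level_variance -[X in `|_ - X|]/(fine S).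
set s2 := bit_mean _ _ _; set s1 := bit_mean _ _ _.
rewrite vE => h2 h1.
have h1' : `|s1 ^+ 2 - mean ^+ 2| <= 2 * (`|mean| + 1) * eta.
  have s1M : `|s1| <= `|mean| + 1.
    rewrite -[s1](subrK mean) (le_trans (ler_normD _ _))// addrC lerD2l.
    exact: le_trans h1 eta1.
  apply: le_trans (sqrL (`|mean| + 1) _ _ _ s1M _) _.
  - by rewrite addr_ge0.
  - by rewrite lerDl.
  - by rewrite ler_wpM2l// mulr_ge0// addr_ge0.
move: h1' h2; rewrite !ler_norml => /andP[? ?] /andP[? ?]; apply/andP; split; lra.
Qed.

End variance_limit.

Section limn_esup_bounds.
Context {R : realType}.
Implicit Types (u : nat -> \bar R) (c : \bar R).

Lemma limn_esup_lt u c : (limn_esup u < c)%E ->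
  exists N, forall n, (N <= n)%N -> (u n < c)%E.
Proof.
rewrite /limn_esup /limf_esup => /ereal_inf_lt[_ [V [N _ NV] <-] Vc].
exists N => n Nn; apply: le_lt_trans Vc; apply: ereal_sup_ubound.
by exists n => //; exact: NV.
Qed.

Lemma limn_esup_ge u c N : (forall n, (N <= n)%N -> (c <= u n)%E) ->
  (c <= limn_esup u)%E.
Proof.
move=> H; apply: le_ereal_inf_tmp => _ [V [N' _ NV] <-].
apply: (@le_trans _ _ (u (maxn N N'))); first by apply: H; rewrite leq_maxl.
by apply: ereal_sup_ubound; exists (maxn N N') => //; apply: NV; exact: leq_maxr.
Qed.

End limn_esup_bounds.

Theorem theorem2p1 (R : realType)
    (d : measure_display) (T : measurableType d) (P : probability T R)
    (x : nat -> nat -> {RV P >-> bool})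
    (lam : probability (cube R) R)
    (f : cube R -> R) :
  iid_symmetric_bits x ->
  is_lebesgue_product lam ->
  measurable_fun setT f ->
  f \in Lfun lam 2%:E ->
  (forall (n : nat) (y : 'I_n.+1 -> {i01 R}),
     lam.-integrable setT (fun z => (f (splice y z))%:E)) ->
  (forall n : nat, riemann_integrable (tail_integral lam f (n := n))) ->
  ((2^-1)%:E * 'V_lam[f] * lne ('V_lam[f] / Nfun x 1 f) <= Nfun x 2 f)%E.
Proof.
move=> xP lamP mf f2 ifs rf.
have if2 : lam.-integrable setT (fun y => (f y ^+ 2)%:E) := Lfun2_integrable_sqr f2.
have mean_fin : ('E_lam[f])%E \is a fin_num.
  by apply: expectation_fin_num; exact: Lfun_subset12 (fin_num_measure _ _ _) _ f2.
have sqr_fin : (\int[lam]_y (f y ^+ 2)%:E)%E \is a fin_num by exact: integrable_fin_num.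
pose v : R := fine (\int[lam]_y (f y ^+ 2)%:E)%E - (\int[lam]_y f y) ^+ 2.
have VE : ('V_lam[f] = v%:E)%E.
  rewrite (varianceE f2) /v EFinB fineK// EFin_expe /Rintegral.
  move: mean_fin; rewrite unlock => mean_fin.
  by rewrite fineK.
have v0 : 0 <= v by rewrite -lee_fin -VE variance_ge0.
have N_ge0 p : (0 <= Nfun x p f)%E.
  apply: (limn_esup_ge (N := 0)) => n _; apply: (limn_esup_ge (N := 0)) => m _.
  by apply: sume_ge0 => j _; apply: sume_ge0 => i _; exact: poweR_ge0.
(* The strict bound [c] passes to the inner upper limit for large n, then to the level sum for large
   m. *)
have key (c lambda : R) : (Nfun x 1 f < c%:E)%E -> 0 < lambda ->
    (((v * (1 + ln lambda) - lambda * c) / 2)%:E <= Nfun x 2 f)%E.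
  move=> Nc l0; apply/lee_addgt0Pr => e e0.
  rewrite -leeBlDr// -EFinB.
  (* The error on the variance is multiplied by 1 + ln lambda, of unknown sign and possibly zero. *)
  have Q0 : 0 < `|1 + ln lambda| + 1 by rewrite ltr_wpDl.
  have [n0 Hv] := level_variance_cvg xP lamP mf if2 ifs rf (erefl v) (divr_gt0 e0 Q0).
  have [n1 Hn] := limn_esup_lt Nc.
  apply: (limn_esup_ge (N := maxn n0 n1)) => n; rewrite geq_max => /andP[n0n n1n].
  have [m0 Hm0] := Hv n n0n; have [m1 Hm1] := limn_esup_lt (Hn n n1n).
  apply: (limn_esup_ge (N := maxn m0 m1)) => m; rewrite geq_max => /andP[m0m m1m].
  apply: le_trans (level_inequality xP lamP mf (@ifs n) (fun=> xpred0) l0 (ltW (Hm1 m m1m))).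
  rewrite lee_fin; have := Hm0 m m0m.
  set lv := level_variance _ _ _ _ _ => Hlv.
  have : `|(lv - v) * (1 + ln lambda)| <= e.
    rewrite normrM (le_trans (ler_wpM2r (normr_ge0 _) Hlv))//.
    by rewrite mulrAC ler_pdivrMr// ler_pM2l// lerDl.
  rewrite ler_norml => /andP[+ _]; lra.
rewrite VE; move: v0; rewrite le_eqVlt => /predU1P[<-|v0].
  by rewrite mule0 mul0e.
(* If N_1 is infinite, the quotient is 0, whose logarithm is minus infinity. *)
have := N_ge0 1%N; case N1E : (Nfun x 1 f) => [r| |]// r0; last first.
  by rewrite invey mule0 le0_lneNy// gt0_muleNy ?leNye// -EFinM lte_fin mulr_gt0// invr_gt0.
rewrite lee_fin in r0; move: r0; rewrite le_eqVlt => /predU1P[r0|r0].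
  suff -> : Nfun x 2 f = +oo%E by rewrite leey.
  (* For N_1 = 0 any c > 0 is allowed. With c = v / lambda the product lambda c = v cancels the 1,
     and v ln lambda / 2 = A is arbitrarily large. *)
  apply/eqyP => A A0; pose lambda := expR (2 * A / v).
  have l0 : 0 < lambda by exact: expR_gt0.
  have := key (v / lambda) lambda; rewrite N1E -r0 lte_fin divr_gt0// => /(_ isT l0).
  congr (_%:E <= _)%E; rewrite /lambda expRK; field.
  by rewrite !gt_eqF ?expR_gt0.
have l0 : 0 < v / r by rewrite divr_gt0.
rewrite inver gt_eqF// -!EFinM lne_EFin// -?EFinM.
apply/lee_addgt0Pr => e e0; rewrite -leeBlDr// -EFinB.
(* At lambda = v / r one has lambda r = v; the excess of [c] over r is chosen to cost exactly [e]
   after multiplication by lambda and halving. *)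
have := key (r + 2 * e / (v / r)) (v / r).
rewrite N1E lte_fin ltrDl !divr_gt0 ?mulr_gt0// => /(_ isT isT).
congr (_%:E <= _)%E; field.
by rewrite !gt_eqF.
Qed.
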